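(* ($\mathbf{ZF}$) The following conditions are all equivalent: (i) $\mathbf{CAC}_{fin}$; (ii) for every iso-dense metric space $\mathbf{X}$, if $\mathbf{X}$ is either limit point compact or totally bounded, then $\mathbf{X}$ is separable; (iii) for every iso-dense metric space $\mathbf{X}$, if $\mathbf{X}$ is either limit point compact or totally bounded, then $\mathbf{X}$ embeds in the Hilbert cube $[0,1]^{\mathbb{N}}$; (iv) for every iso-dense metric space $\mathbf{X}$, if $\mathbf{X}$ is either limit point compact or totally bounded, then $|\mathrm{Iso}(X)|\le|\mathbb{R}|$; (v) for every iso-dense metric space $\mathbf{X}$, if $\mathbf{X}$ is either limit point compact or totally bounded, then the set $\mathrm{Iso}(X)$ is countable. In (ii)-(v), the term ''iso-dense'' can be replaced with ''scattered''.
   Context: The theorem is in $\mathbf{ZF}$ (no axiom of choice). $\mathbf{CAC}_{fin}$: every denumerable (countably infinite) family of non-empty finite sets has a choice function. Topological notions for a metric space $\langle X,d\rangle$ refer to the topology $\tau(d)$ induced by $d$; ''embeds'' means homeomorphically as a topological space. $\mathrm{Iso}(X)$ is the set of isolated points of $\mathbf{X}$. $\mathbf{X}$ is iso-dense if $\mathrm{Iso}(X)$ is dense in $\mathbf{X}$; scattered if every non-empty subspace has an isolated point. A space is limit point compact if every infinite subset has an accumulation point in it. A metric space is totally bounded if for every $\varepsilon>0$ it is covered by finitely many balls of radius $\varepsilon$. $|A|\le|B|$ means there is an injection from $A$ into $B$. *)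

(* Defs.v *)
(** Stdlib only: no choice operator or real-number library is used.

    Rocq's own sets and functions are not a faithful rendering of ZF, because
    the usual classical axioms of Rocq prove the axiom of choice for them.
    "ZF proves phi" is therefore expressed as "phi holds in every model of the
    first-order theory ZF".  A model is a type with an arbitrary binary relation.
    Every set-theoretic notion below is a first-order formula over it: all
    quantifiers range over elements of the model, and finiteness, the natural
    numbers, functions and the reals are those of the model.  Parameters of type
    [M -> Prop] are classes; they are only ever instantiated with definable
    ones and never quantified over. *)

Set Implicit Arguments.
Unset Strict Implicit.

Record set_structure : Type := SetStructure {
  carrier :> Type;
  mem : carrier -> carrier -> Prop
}.

Notation "x ∈ y" := (mem x y) (at level 70, no associativity).

(** * First-order ZF *)

(** De Bruijn indices: a quantifier binds variable 0 and shifts the others. *)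
Inductive formula : Type :=
| FMem (i j : nat)
| FEq (i j : nat)
| FFalse
| FImp (phi psi : formula)
| FAnd (phi psi : formula)
| FOr (phi psi : formula)
| FAll (phi : formula)
| FEx (phi : formula).

Definition scons {A : Type} (a : A) (v : nat -> A) (n : nat) : A :=
  match n with
  | O => a
  | S m => v m
  end.

Fixpoint sat {M : set_structure} (v : nat -> M) (phi : formula) : Prop :=
  match phi with
  | FMem i j => v i ∈ v j
  | FEq i j => v i = v j
  | FFalse => False
  | FImp p q => sat v p -> sat v q
  | FAnd p q => sat v p /\ sat v q
  | FOr p q => sat v p \/ sat v q
  | FAll p => forall a : M, sat (scons a v) p
  | FEx p => exists a : M, sat (scons a v) p
  end.

Section SetNotions.
Context {M : set_structure}.
Implicit Types a b c f p s t u w x y z : M.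

Definition nonempty a : Prop := exists x, x ∈ a.
Definition subset a b : Prop := forall x, x ∈ a -> x ∈ b.
Definition is_empty a : Prop := forall x, ~ x ∈ a.
Definition is_upair p x y : Prop := forall z, z ∈ p <-> z = x \/ z = y.

Definition is_succ s x : Prop := forall z, z ∈ s <-> z ∈ x \/ z = x.
Definition inductive_set a : Prop :=
  (exists e, is_empty e /\ e ∈ a) /\
  (forall x, x ∈ a -> exists s, is_succ s x /\ s ∈ a).
Definition is_omega w : Prop :=
  inductive_set w /\ forall a, inductive_set a -> subset w a.

(** Kuratowski pairs *)
Definition is_opair p x y : Prop :=
  exists s t, is_upair s x x /\ is_upair t x y /\ is_upair p s t.
Definition is_prod c a b : Prop :=
  forall p, p ∈ c <-> exists x y, x ∈ a /\ y ∈ b /\ is_opair p x y.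

(** [rel f x y]: the pair (x, y) is in f; for a function f, f(x) = y. *)
Definition rel f x y : Prop := exists p, is_opair p x y /\ p ∈ f.
Definition is_fun f a b : Prop :=
  (forall p, p ∈ f -> exists x y, x ∈ a /\ y ∈ b /\ is_opair p x y) /\
  (forall x, x ∈ a -> exists! y, rel f x y).
Definition injective f : Prop :=
  forall x x' y, rel f x y -> rel f x' y -> x = x'.
Definition surjective f b : Prop :=
  forall y, y ∈ b -> exists x, rel f x y.

(** [op f x y z]: f(x, y) = z. *)
Definition op f x y z : Prop := exists q, is_opair q x y /\ rel f q z.
Definition is_fun2 f a b c : Prop := exists p, is_prod p a b /\ is_fun f p c.

Definition card_le a b : Prop := exists f, is_fun f a b /\ injective f.
Definition equipotent a b : Prop :=
  exists f, is_fun f a b /\ injective f /\ surjective f b.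
Definition finite a : Prop := exists w n, is_omega w /\ n ∈ w /\ equipotent a n.
Definition infinite a : Prop := ~ finite a.
Definition denumerable a : Prop := exists w, is_omega w /\ equipotent a w.
Definition countable a : Prop := finite a \/ denumerable a.

End SetNotions.

Record ZF_model (M : set_structure) : Prop := {
  zf_extensionality : forall a b : M, (forall x, x ∈ a <-> x ∈ b) -> a = b;
  zf_foundation : forall a : M,
    nonempty a -> exists x, x ∈ a /\ forall y, y ∈ x -> ~ y ∈ a;
  zf_pairing : forall x y : M, exists p, is_upair p x y;
  zf_union : forall a : M, exists u, forall x, x ∈ u <-> exists b, b ∈ a /\ x ∈ b;
  zf_power : forall a : M, exists p, forall b, b ∈ p <-> subset b a;
  zf_infinity : exists a : M, inductive_set a;
  zf_separation : forall (phi : formula) (v : nat -> M) (a : M),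
    exists b, forall x, x ∈ b <-> x ∈ a /\ sat (scons x v) phi;
  zf_replacement : forall (phi : formula) (v : nat -> M) (a : M),
    (forall x y z, x ∈ a ->
       sat (scons y (scons x v)) phi -> sat (scons z (scons x v)) phi -> y = z) ->
    exists b, forall y, y ∈ b <-> exists x, x ∈ a /\ sat (scons y (scons x v)) phi
}.

Definition CAC_fin (M : set_structure) : Prop :=
  forall F : M,
    denumerable F ->
    (forall a, a ∈ F -> nonempty a /\ finite a) ->
    exists u f : M, is_fun f F u /\ forall a x, rel f a x -> x ∈ a.

(** * The real numbers of the model *)

Record field_data (M : set_structure) : Type := FieldData {
  reals : M;
  radd : M;
  rmul : M;
  rle : M;
  rzero : M;
  rone : M
}.

Definition rlt {M : set_structure} (R : field_data M) (x y : M) : Prop :=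
  rel (rle R) x y /\ x <> y.

(** Dedekind-complete ordered fields: within ZF they exist and are unique up to
    a unique isomorphism, so this describes the set of reals. *)
Record is_real_field {M : set_structure} (R : field_data M) : Prop := {
  rf_zero : rzero R ∈ reals R;
  rf_one : rone R ∈ reals R;
  rf_add : is_fun2 (radd R) (reals R) (reals R) (reals R);
  rf_mul : is_fun2 (rmul R) (reals R) (reals R) (reals R);
  rf_le : forall x y, rel (rle R) x y -> x ∈ reals R /\ y ∈ reals R;
  rf_addA : forall x y z s t l r,
    op (radd R) x y s -> op (radd R) s z l ->
    op (radd R) y z t -> op (radd R) x t r -> l = r;
  rf_addC : forall x y s, op (radd R) x y s -> op (radd R) y x s;
  rf_add0 : forall x, x ∈ reals R -> op (radd R) x (rzero R) x;
  rf_addN : forall x, x ∈ reals R ->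
    exists y, y ∈ reals R /\ op (radd R) x y (rzero R);
  rf_mulA : forall x y z s t l r,
    op (rmul R) x y s -> op (rmul R) s z l ->
    op (rmul R) y z t -> op (rmul R) x t r -> l = r;
  rf_mulC : forall x y s, op (rmul R) x y s -> op (rmul R) y x s;
  rf_mul1 : forall x, x ∈ reals R -> op (rmul R) x (rone R) x;
  rf_mulV : forall x, x ∈ reals R -> x <> rzero R ->
    exists y, y ∈ reals R /\ op (rmul R) x y (rone R);
  rf_distr : forall x y z s p q l r,
    op (radd R) y z s -> op (rmul R) x s l ->
    op (rmul R) x y p -> op (rmul R) x z q -> op (radd R) p q r -> l = r;
  rf_01 : rzero R <> rone R;
  rf_le_refl : forall x, x ∈ reals R -> rel (rle R) x x;
  rf_le_anti : forall x y, rel (rle R) x y -> rel (rle R) y x -> x = y;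
  rf_le_trans : forall x y z, rel (rle R) x y -> rel (rle R) y z -> rel (rle R) x z;
  rf_le_total : forall x y, x ∈ reals R -> y ∈ reals R ->
    rel (rle R) x y \/ rel (rle R) y x;
  rf_le_add : forall x y z s t, rel (rle R) x y ->
    op (radd R) x z s -> op (radd R) y z t -> rel (rle R) s t;
  rf_le_mul : forall x y p, rel (rle R) (rzero R) x -> rel (rle R) (rzero R) y ->
    op (rmul R) x y p -> rel (rle R) (rzero R) p;
  rf_complete : forall A : M, subset A (reals R) -> nonempty A ->
    (exists b, b ∈ reals R /\ forall x, x ∈ A -> rel (rle R) x b) ->
    exists l, l ∈ reals R /\ (forall x, x ∈ A -> rel (rle R) x l) /\
      forall b, b ∈ reals R -> (forall x, x ∈ A -> rel (rle R) x b) ->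
        rel (rle R) l b
}.

(** * Topology *)

(** A space is a set X with the class [O] of its open sets. *)
Section Topology.
Context {M : set_structure}.
Implicit Types A D F I U V X Y c f g h n u w x y : M.
Implicit Types O OX OY OI : M -> Prop.

Definition isolated O x : Prop := exists U, O U /\ forall y, y ∈ U <-> y = x.
Definition is_Iso O I : Prop := forall x, x ∈ I <-> isolated O x.
Definition dense X O D : Prop :=
  subset D X /\
  forall U, O U -> nonempty U -> exists x, x ∈ U /\ x ∈ D.
Definition separable X O : Prop := exists D, countable D /\ dense X O D.

Definition subspace_open O A V : Prop :=
  exists U, O U /\ forall x, x ∈ V <-> x ∈ U /\ x ∈ A.

Definition iso_dense X O : Prop := exists I, is_Iso O I /\ dense X O I.
Definition scattered X O : Prop :=
  forall A, subset A X -> nonempty A ->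
    exists x, x ∈ A /\ isolated (subspace_open O A) x.

Definition accumulation_point O A x : Prop :=
  forall U, O U -> x ∈ U -> exists y, y ∈ U /\ y ∈ A /\ y <> x.
Definition limit_point_compact X O : Prop :=
  forall A, subset A X -> infinite A ->
    exists x, x ∈ X /\ accumulation_point O A x.

Definition continuous f X OX OY : Prop :=
  forall V, OY V ->
    exists U, OX U /\
      forall x, x ∈ U <-> x ∈ X /\ exists y, rel f x y /\ y ∈ V.
Definition homeomorphic X OX Y OY : Prop :=
  exists h g, is_fun h X Y /\ is_fun g Y X /\
    (forall x y, rel h x y <-> rel g y x) /\
    continuous h X OX OY /\ continuous g Y OY OX.
Definition embeds X OX Y OY : Prop :=
  exists A, subset A Y /\ homeomorphic X OX A (subspace_open OY A).

(** The product topology on a set Y of functions from w to a space with open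
    sets [OI].  A basic open box is a function u from a finite subset F of w to
    open sets. *)
Definition in_box u f : Prop :=
  forall n U x, rel u n U -> rel f n x -> x ∈ U.
Definition product_open w OI Y V : Prop :=
  subset V Y /\
  forall f, f ∈ V ->
    exists F u c, subset F w /\ finite F /\
      is_fun u F c /\ (forall n U, rel u n U -> OI U) /\
      in_box u f /\ forall g, g ∈ Y -> in_box u g -> g ∈ V.

End Topology.

(** * Metric spaces *)

Section Metric.
Context {M : set_structure}.
Context (R : field_data M).
Implicit Types B C I U X Y c d e r w x y z : M.

Definition is_metric X d : Prop :=
  is_fun2 d X X (reals R) /\
  (forall x y r, op d x y r -> rel (rle R) (rzero R) r) /\
  (forall x y r, op d x y r -> (r = rzero R <-> x = y)) /\
  (forall x y r, op d x y r -> op d y x r) /\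
  (forall x y z r s t q,
     op d x y r -> op d y z s -> op d x z t -> op (radd R) r s q ->
     rel (rle R) t q).

Definition is_ball X d c r B : Prop :=
  forall y, y ∈ B <-> y ∈ X /\ exists s, op d c y s /\ rlt R s r.

Definition metric_open X d U : Prop :=
  subset U X /\
  forall x, x ∈ U ->
    exists r B, rlt R (rzero R) r /\ is_ball X d x r B /\ subset B U.

Definition totally_bounded X d : Prop :=
  forall r, rlt R (rzero R) r ->
    exists C, finite C /\
      (forall B, B ∈ C -> exists x, x ∈ X /\ is_ball X d x r B) /\
      (forall y, y ∈ X -> exists B, B ∈ C /\ y ∈ B).

Definition is_unit_interval I : Prop :=
  forall x, x ∈ I <-> rel (rle R) (rzero R) x /\ rel (rle R) x (rone R).

(** e(x, y) = |x - y|: the nonnegative r with x + r = y or y + r = x. *)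
Definition is_usual_metric I e : Prop :=
  is_fun2 e I I (reals R) /\
  forall x y r, op e x y r ->
    rel (rle R) (rzero R) r /\ (op (radd R) x r y \/ op (radd R) y r x).

Definition embeds_in_Hilbert_cube X (OX : M -> Prop) : Prop :=
  exists w I e Y,
    is_omega w /\ is_unit_interval I /\ is_usual_metric I e /\
    (forall f, f ∈ Y <-> is_fun f w I) /\
    embeds X OX Y (product_open w (metric_open I e) Y).

(** Every metric space whose topology satisfies [K], and which is limit point
    compact or totally bounded, has property [C]; both [K] and [C] are given the
    set of points and the class of open sets. *)
Definition for_metric_spaces (K C : M -> (M -> Prop) -> Prop) : Prop :=
  forall X d, is_metric X d ->
    K X (metric_open X d) ->
    limit_point_compact X (metric_open X d) \/ totally_bounded X d ->
    C X (metric_open X d).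

Definition Iso_le_continuum (X : M) (O : M -> Prop) : Prop :=
  exists I, is_Iso O I /\ card_le I (reals R).
Definition Iso_countable (X : M) (O : M -> Prop) : Prop :=
  exists I, is_Iso O I /\ countable I.

End Metric.

(* Main.v *)
(** Both kinds of smallness make each set
    [A_n = {x | d(x, y) >= e_n for all y <> x}], with [e_n] decreasing to 0, finite:
    an accumulation point of [A_n] would be within [e_n] of a point of [A_n], and in a
    finite cover by balls of radius [e_n] every point of [A_n] must be a center.  The
    isolated points are the union of the [A_n], hence form a countable set under
    [CAC_fin].  In an
    iso-dense space they are then a countable dense set, and truncated distances to
    them embed the space in the Hilbert cube.

    Conversely, each conclusion makes the set of isolated points linearly orderable:
    a set that injects into the reals is, and the Hilbert cube is ordered
    lexicographically.  For a denumerable family [F] of finite sets, metrize the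
    disjoint union of [F] together with one limit point so that the [n]-th member is
    at distance [e_n] from it.  This is a scattered totally bounded space in which
    all points of the members are isolated, and picking the least element of each
    member is a choice function. *)

From Stdlib Require Import FunctionalExtensionality ClassicalEpsilon Arith Ring.
Require Import Defs.

Set Implicit Arguments.

(** * Definable predicates *)

(** Inside a model, separation, replacement and induction apply to formulas only, and this shapes
    the proof: each class or class function that is turned into a set carries a [definable]
    certificate. The classical choice operator of Rocq merely names elements from outside the model;
    a function picked with it gets no certificate and cannot become a function of the model, so no
    choice axiom leaks in.

    Each A_n can be listed, but a sequence of listings is a choice. A finite set has only finitely
    many linear orders, so choosing an order on every A_n is a choice from finite sets, which
    [CAC_fin] grants. Conversely, one definable linear order that covers all members of the family
    at once singles out an element of each finite member, with no further choice.

    The distances e_n meet two demands. Being positive, they isolate the points of the members;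
    tending to 0, they leave only finitely many points outside any ball about the limit point,
    whence total boundedness. As the reals are any complete ordered field of the model, such a
    sequence has to be built by recursion inside it. *)

Definition up (s : nat -> nat) (n : nat) : nat :=
  match n with O => O | S m => S (s m) end.

Fixpoint rename (s : nat -> nat) (phi : formula) : formula :=
  match phi with
  | FMem i j => FMem (s i) (s j)
  | FEq i j => FEq (s i) (s j)
  | FFalse => FFalse
  | FImp p q => FImp (rename s p) (rename s q)
  | FAnd p q => FAnd (rename s p) (rename s q)
  | FOr p q => FOr (rename s p) (rename s q)
  | FAll p => FAll (rename (up s) p)
  | FEx p => FEx (rename (up s) p)
  end.

Lemma scons_up (M : Type) (a : M) v s :
  (fun n => scons a v (up s n)) = scons a (fun n => v (s n)).
Proof. apply functional_extensionality; intros [|n]; reflexivity. Qed.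

Lemma sat_rename (M : set_structure) phi : forall s (v : nat -> M),
  sat v (rename s phi) <-> sat (fun n => v (s n)) phi.
Proof.
  induction phi; intros s v; simpl; try tauto.
  1-3: rewrite IHphi1, IHphi2; tauto.
  - assert (E : forall a, sat (scons a v) (rename (up s) phi) <->
      sat (scons a (fun n => v (s n))) phi)
      by (intros a; rewrite IHphi, scons_up; tauto).
    split; intros H a; apply E, H.
  - assert (E : forall a, sat (scons a v) (rename (up s) phi) <->
      sat (scons a (fun n => v (s n))) phi)
      by (intros a; rewrite IHphi, scons_up; tauto).
    split; intros [a H]; exists a; apply E, H.
Qed.

Section Definability.
Context {M : set_structure}.
Implicit Types (P Q : (nat -> M) -> Prop) (t : (nat -> M) -> M) (v : nat -> M).

(** A variable of a formula stands for a variable of the environment or for a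
    parameter; [definable] predicates are those to which separation and
    replacement apply. *)
Definition assign (r : nat -> nat + M) v (i : nat) : M :=
  match r i with inl j => v j | inr c => c end.

Definition definable P : Prop :=
  exists phi r, forall v, P v <-> sat (assign r v) phi.

(** Formulas have no function symbols, so a term is certified by its graph: variable 0 is the value,
    and the arguments move up by one. *)
Definition definable_term t : Prop :=
  definable (fun v => v 0 = t (fun n => v (S n))).

Lemma definable_ext P Q : (forall v, P v <-> Q v) -> definable Q -> definable P.
Proof.
  intros E (phi & r & H); exists phi, r; intros v; rewrite E; apply H.
Qed.

(** Assignments compose, so the formula stays the same and only the reading of its variables
    changes. Weakening, permuting variables and fixing parameters are all instances. *)
Lemma definable_assign P r : definable P -> definable (fun v => P (assign r v)).
Proof.
  intros (phi & q & H).
  exists phi, (fun i => match q i with inl j => r j | inr c => inr c end).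
  intros v; rewrite H.
  enough (E : assign q (assign r v) =
    assign (fun i => match q i with inl j => r j | inr c => inr c end) v)
    by (rewrite E; reflexivity).
  apply functional_extensionality; intros i; unfold assign.
  destruct (q i); reflexivity.
Qed.

Lemma definable_False : definable (fun _ => False).
Proof. exists FFalse, inl; intros v; simpl; tauto. Qed.

Lemma definable_mem_atom i j : definable (fun v => v i ∈ v j).
Proof. exists (FMem i j), inl; intros v; simpl; tauto. Qed.

Lemma definable_eq_atom i j : definable (fun v => v i = v j).
Proof. exists (FEq i j), inl; intros v; simpl; tauto. Qed.

Lemma definable_eq_const i c : definable (fun v => v i = c).
Proof.
  exists (FEq 0 1), (fun k => match k with O => inl i | S _ => inr c end).
  intros v; simpl; tauto.
Qed.

(** The two certificates interpret their variables independently; even indices carry those of the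
    first and odd indices those of the second, so that a single assignment serves the compound
    formula. *)
Lemma definable_binary (C : formula -> formula -> formula)
    (K : Prop -> Prop -> Prop) P Q :
  (forall v phi psi, sat v (C phi psi) <-> K (sat v phi) (sat v psi)) ->
  (forall A A' B B' : Prop, (A <-> A') -> (B <-> B') -> (K A B <-> K A' B')) ->
  definable P -> definable Q -> definable (fun v => K (P v) (Q v)).
Proof.
  intros HC HK (phi & r & H) (psi & q & H').
  exists (C (rename (fun i => 2 * i) phi) (rename (fun i => S (2 * i)) psi)).
  exists (fun i => if Nat.even i then r (Nat.div2 i) else q (Nat.div2 i)).
  intros v; rewrite HC; apply HK; rewrite sat_rename.
  - rewrite H; match goal with |- sat ?a _ <-> sat ?b _ => enough (E : a = b)
      by (rewrite E; reflexivity) end.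
    apply functional_extensionality; intros i; unfold assign.
    rewrite Nat.even_mul, Nat.div2_double; reflexivity.
  - rewrite H'; match goal with |- sat ?a _ <-> sat ?b _ => enough (E : a = b)
      by (rewrite E; reflexivity) end.
    apply functional_extensionality; intros i; unfold assign.
    rewrite Nat.div2_succ_double, Nat.even_succ, Nat.odd_mul; reflexivity.
Qed.

Lemma definable_and P Q :
  definable P -> definable Q -> definable (fun v => P v /\ Q v).
Proof. apply (definable_binary FAnd and); intros; simpl; tauto. Qed.

Lemma definable_or P Q :
  definable P -> definable Q -> definable (fun v => P v \/ Q v).
Proof. apply (definable_binary FOr or); intros; simpl; tauto. Qed.

Lemma definable_imp P Q :
  definable P -> definable Q -> definable (fun v => P v -> Q v).
Proof. apply (definable_binary FImp (fun A B => A -> B)); intros; simpl; tauto. Qed.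

Lemma definable_not P : definable P -> definable (fun v => ~ P v).
Proof. intros H; apply (definable_imp H definable_False). Qed.

Lemma definable_iff P Q :
  definable P -> definable Q -> definable (fun v => P v <-> Q v).
Proof. intros; apply definable_and; apply definable_imp; assumption. Qed.

(** Splits an assignment at a binder: [s] sends to index 0 whatever reads the bound variable, and
    [r'] reads the rest from the outer environment. Where [r i] is [inl 0], the value of [r'] is a
    dummy that [s] never points to. *)
Lemma assign_scons (r : nat -> nat + M) a v :
  let s i := match r i with inl O => O | _ => S i end in
  let r' i := match r i with inl (S j) => inl j | x => x end in
  assign r (scons a v) = (fun i => scons a (assign r' v) (s i)).
Proof.
  intros s r'; apply functional_extensionality; intros i.
  unfold assign, s, r'; simpl.
  destruct (r i) as [[|j]|c] eqn:E; simpl; rewrite ?E; reflexivity.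
Qed.

(** [zf_separation] takes a formula and an environment, so the assignment [r] is absorbed into
    these, leaving variable 0 for the element. [sat_pull2] does the same with two distinguished
    variables for [zf_replacement]. *)
Lemma sat_pull (r : nat -> nat + M) v phi : exists psi w, forall a,
  sat (assign r (scons a v)) phi <-> sat (scons a w) psi.
Proof.
  eexists (rename (fun i => match r i with inl O => O | _ => S i end) phi), _.
  intros a; rewrite sat_rename, (assign_scons r a v); reflexivity.
Qed.

Lemma sat_pull2 (r : nat -> nat + M) v phi : exists psi w, forall a b,
  sat (assign r (scons b (scons a v))) phi <-> sat (scons b (scons a w)) psi.
Proof.
  set (r' := fun i => match r i with inl (S j) => inl j | x => x end).
  eexists (rename (up (fun i => match r' i with inl O => O | _ => S i end))
    (rename (fun i => match r i with inl O => O | _ => S i end) phi)), _.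
  intros a b; rewrite sat_rename, scons_up, (assign_scons r b (scons a v)).
  fold r'; rewrite (assign_scons r' a v), <- sat_rename; reflexivity.
Qed.

Lemma definable_ex (Q : (nat -> M) -> M -> Prop) :
  definable (fun v => Q (fun n => v (S n)) (v 0)) ->
  definable (fun v => exists a, Q v a).
Proof.
  intros (phi & r & H).
  set (s := fun i => match r i with inl O => O | _ => S i end).
  set (r' := fun i => match r i with inl (S j) => inl j | x => x end).
  exists (FEx (rename s phi)), r'.
  intros v; simpl.
  assert (E : forall a, Q v a <-> sat (scons a (assign r' v)) (rename s phi)).
  { intros a; rewrite sat_rename.
    pose proof (assign_scons r a v) as E; cbv zeta in E; fold s r' in E.
    rewrite <- E; apply (H (scons a v)). }
  split; intros [a Ha]; exists a; apply E, Ha.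
Qed.

Lemma definable_all (Q : (nat -> M) -> M -> Prop) :
  definable (fun v => Q (fun n => v (S n)) (v 0)) ->
  definable (fun v => forall a, Q v a).
Proof.
  intros (phi & r & H).
  set (s := fun i => match r i with inl O => O | _ => S i end).
  set (r' := fun i => match r i with inl (S j) => inl j | x => x end).
  exists (FAll (rename s phi)), r'.
  intros v; simpl.
  assert (E : forall a, Q v a <-> sat (scons a (assign r' v)) (rename s phi)).
  { intros a; rewrite sat_rename.
    pose proof (assign_scons r a v) as E; cbv zeta in E; fold s r' in E.
    rewrite <- E; apply (H (scons a v)). }
  split; intros Ha a; apply E, Ha.
Qed.

Lemma definable_term_var k : definable_term (fun v => v k).
Proof. exact (definable_eq_atom 0 (S k)). Qed.

Lemma definable_term_const c : definable_term (fun _ => c).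
Proof. exact (definable_eq_const 0 c). Qed.

Lemma definable_term_shift t :
  definable_term t -> definable_term (fun v => t (fun n => v (S n))).
Proof.
  intros H.
  exact (definable_assign
    (fun i => match i with O => inl O | S j => inl (S (S j)) end) H).
Qed.

(** Quantifying over a value [a = t v] takes the place of substituting a term into a formula. *)
Lemma definable_app (P : (nat -> M) -> M -> Prop) t :
  definable (fun v => P (fun n => v (S n)) (v 0)) -> definable_term t ->
  definable (fun v => P v (t v)).
Proof.
  intros H Ht.
  apply definable_ext with (Q := fun v => exists a, a = t v /\ P v a).
  - intros v; split.
    + intros; exists (t v); auto.
    + intros (a & -> & Ha); exact Ha.
  - apply (definable_ex (fun v a => a = t v /\ P v a)).
    exact (definable_and Ht H).
Qed.

Lemma definable_app1 (P : M -> Prop) s :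
  definable (fun v => P (v 0)) -> definable_term s ->
  definable (fun v => P (s v)).
Proof.
  intros H Hs; exact (definable_app (fun _ => P) H Hs).
Qed.

Lemma definable_app2 (P : M -> M -> Prop) s t :
  definable (fun v => P (v 0) (v 1)) -> definable_term s -> definable_term t ->
  definable (fun v => P (s v) (t v)).
Proof.
  intros H Hs Ht; apply (definable_app (fun v x => P (s v) x)); [|exact Ht].
  apply (definable_app (fun v x => P x (v 0)));
    [exact H | exact (definable_term_shift Hs)].
Qed.

Lemma definable_app3 (P : M -> M -> M -> Prop) s t u :
  definable (fun v => P (v 0) (v 1) (v 2)) ->
  definable_term s -> definable_term t -> definable_term u ->
  definable (fun v => P (s v) (t v) (u v)).
Proof.
  intros H Hs Ht Hu.
  apply (definable_app (fun v x => P (s v) (t v) x)); [|exact Hu].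
  apply (definable_app (fun v x => P (s (fun n => v (S n))) x (v 0)));
    [|exact (definable_term_shift Ht)].
  apply (definable_app (fun v x => P x (v 0) (v 1)));
    [exact H | exact (definable_term_shift (definable_term_shift Hs))].
Qed.

Lemma definable_app4 (P : M -> M -> M -> M -> Prop) s t u w :
  definable (fun v => P (v 0) (v 1) (v 2) (v 3)) ->
  definable_term s -> definable_term t -> definable_term u -> definable_term w ->
  definable (fun v => P (s v) (t v) (u v) (w v)).
Proof.
  intros H Hs Ht Hu Hw.
  apply (definable_app (fun v x => P (s v) (t v) (u v) x)); [|exact Hw].
  apply (definable_app
    (fun v x => P (s (fun n => v (S n))) (t (fun n => v (S n))) x (v 0)));
    [|exact (definable_term_shift Hu)].
  apply (definable_app (fun v x => P (s (fun n => v (S (S n)))) x (v 0) (v 1)));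
    [|exact (definable_term_shift (definable_term_shift Ht))].
  apply (definable_app (fun v x => P x (v 0) (v 1) (v 2))); [exact H|].
  exact (definable_term_shift (definable_term_shift (definable_term_shift Hs))).
Qed.

End Definability.

(** Syntax-directed: the patterns [@?P v] abstract the environment from the parts of a connective,
    certificates among the hypotheses act as further atoms, and a term that does not mention [v]
    becomes a parameter. *)
Ltac definable_core :=
  cbv beta;
  lazymatch goal with
  | |- definable (fun v => @?P v /\ @?Q v) => apply (@definable_and _ P Q); cbv beta
  | |- definable (fun v => @?P v \/ @?Q v) => apply (@definable_or _ P Q); cbv beta
  | |- definable (fun v => @?P v <-> @?Q v) => apply (@definable_iff _ P Q); cbv beta
  | |- definable (fun v => ~ @?P v) => apply (@definable_not _ P); cbv beta
  | |- definable (fun v => False) => apply definable_False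
  | |- definable (fun v => @?P v -> @?Q v) => apply (@definable_imp _ P Q); cbv beta
  | |- definable (fun v => exists a, @?P v a) => apply (@definable_ex _ P); cbv beta
  | |- definable (fun v => forall a, @?P v a) => apply (@definable_all _ P); cbv beta
  | |- definable (fun v => @?s v ∈ @?t v) =>
      apply (@definable_app2 _ _ s t (definable_mem_atom 0 1)); cbv beta
  | |- definable (fun v => @?s v = @?t v) =>
      apply (@definable_app2 _ _ s t (definable_eq_atom 0 1)); cbv beta
  | H : definable (fun v => ?P (v 0)) |- definable (fun v => ?P (@?s v)) =>
      apply (@definable_app1 _ P s H); cbv beta
  | H : definable (fun v => ?P (v 0) (v 1)) |-
      definable (fun v => ?P (@?s v) (@?t v)) =>
      apply (@definable_app2 _ P s t H); cbv beta
  | H : definable (fun v => ?P (v 0) (v 1) (v 2)) |-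
      definable (fun v => ?P (@?s v) (@?t v) (@?u v)) =>
      apply (@definable_app3 _ P s t u H); cbv beta
  | |- definable_term (fun v => v ?k) => apply definable_term_var
  | |- definable_term (fun v => ?c) => apply definable_term_const
  end.

Create HintDb definable.
Hint Extern 0 (definable _) => definable_core : definable.
Hint Extern 0 (definable_term _) => definable_core : definable.
Ltac definability := cbv beta; auto 200 with definable nocore.

(** * Definability of the set-theoretic notions *)

Section Notions.
Context {M : set_structure}.
Implicit Types s t u w : (nat -> M) -> M.

Lemma definable_nonempty s : definable_term s -> definable (fun v => nonempty (s v)).
Proof. apply (definable_app1 nonempty); unfold nonempty; definability. Qed.

Lemma definable_subset s t : definable_term s -> definable_term t ->
  definable (fun v => subset (s v) (t v)).
Proof. apply (definable_app2 subset); unfold subset; definability. Qed.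

Lemma definable_rel s t u :
  definable_term s -> definable_term t -> definable_term u ->
  definable (fun v => rel (s v) (t v) (u v)).
Proof.
  apply (definable_app3 rel); unfold rel, is_opair, is_upair; definability.
Qed.
Hint Resolve definable_nonempty definable_subset definable_rel : definable.

Lemma definable_injective s : definable_term s -> definable (fun v => injective (s v)).
Proof. apply (definable_app1 injective); unfold injective; definability. Qed.

Lemma definable_surjective s t : definable_term s -> definable_term t ->
  definable (fun v => surjective (s v) (t v)).
Proof. apply (definable_app2 surjective); unfold surjective; definability. Qed.

Lemma definable_is_fun s t u :
  definable_term s -> definable_term t -> definable_term u ->
  definable (fun v => is_fun (s v) (t v) (u v)).
Proof.
  apply (definable_app3 is_fun).
  unfold is_fun, unique, is_opair, is_upair; definability.
Qed.

Lemma definable_op s t u w :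
  definable_term s -> definable_term t -> definable_term u -> definable_term w ->
  definable (fun v => op (s v) (t v) (u v) (w v)).
Proof.
  apply (definable_app4 op); unfold op, is_opair, is_upair; definability.
Qed.

Hint Resolve definable_injective definable_surjective definable_is_fun : definable.

Lemma definable_equipotent s t : definable_term s -> definable_term t ->
  definable (fun v => equipotent (s v) (t v)).
Proof. apply (definable_app2 equipotent); unfold equipotent; definability. Qed.
Hint Resolve definable_equipotent : definable.

Lemma definable_finite s : definable_term s -> definable (fun v => finite (s v)).
Proof.
  apply (definable_app1 finite).
  unfold finite, is_omega, inductive_set, is_empty, is_succ; definability.
Qed.

End Notions.

Hint Resolve definable_nonempty definable_subset definable_rel definable_injective
  definable_surjective definable_is_fun definable_op definable_equipotent
  definable_finite : definable.

Lemma definable_ex_unique (M : set_structure) (P : (nat -> M) -> M -> Prop) :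
  definable (fun v => P (fun n => v (S n)) (v 0)) ->
  definable (fun v => exists! y, P v y).
Proof.
  intros H; unfold unique.
  apply (definable_ex (fun v x => P v x /\ forall y, P v y -> x = y)).
  apply definable_and; [exact H|].
  apply (definable_all (fun v y => P (fun n => v (S n)) y -> v 0 = y)).
  apply definable_imp; [|definability].
  exact (definable_assign
    (fun i => match i with O => inl O | S j => inl (S (S j)) end) H).
Qed.

Section ZF.
Context {M : set_structure} (HZF : ZF_model M).
Implicit Types a b c f g p u w x y z A B X Y : M.
Implicit Types s t : (nat -> M) -> M.
Implicit Types (P Q : M -> Prop) (F G : M -> M).

(** * Operations of the model *)

Lemma model_inhabited : inhabited M.
Proof. destruct (zf_infinity HZF) as [a _]; exact (inhabits a). Qed.

Definition junk : M := epsilon model_inhabited (fun _ => True).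

(** The fixed value [junk] makes [the] definable also where the description
    fails. *)
Definition the P : M :=
  epsilon model_inhabited
    (fun y => unique P y \/ (~ (exists! z, P z) /\ y = junk)).

Lemma the_char P : unique P (the P) \/ (~ (exists! z, P z) /\ the P = junk).
Proof.
  unfold the; apply epsilon_spec.
  destruct (classic (exists! z, P z)) as [[z Hz]|H]; [exists z | exists junk]; auto.
Qed.

Lemma the_spec P : (exists! y, P y) -> P (the P).
Proof. intros H; destruct (the_char P) as [[K _]|[K _]]; tauto. Qed.

Lemma the_eq P y : P y -> (forall z, P z -> z = y) -> the P = y.
Proof.
  intros Hy H; apply H, the_spec.
  exists y; split; [exact Hy | intros z Hz; symmetry; auto].
Qed.

Lemma definable_the (P : (nat -> M) -> M -> Prop) :
  definable (fun v => P (fun n => v (S n)) (v 0)) ->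
  definable_term (fun v => the (P v)).
Proof.
  intros H; unfold definable_term.
  apply definable_ext with (Q := fun v =>
    let P' := P (fun n => v (S n)) in
    (P' (v 0) /\ forall y, P' y -> v 0 = y) \/ (~ (exists! z, P' z) /\ v 0 = junk)).
  - intros v; set (P' := P (fun n => v (S n))); cbv zeta.
    destruct (the_char P') as [K|[K E]]; split.
    + intros ->; left; exact K.
    + intros [[K1 K2]|[K1 _]].
      * apply K2, K.
      * destruct K1; exists (the P'); exact K.
    + intros ->; right; auto.
    + intros [K'|[_ ->]]; [|symmetry; exact E].
      destruct K; exists (v 0); exact K'.
  - assert (H' : definable (fun v => P (fun n => v (S (S n))) (v 0)))
      by exact (definable_assign (fun i => match i with O => inl O
                                   | S j => inl (S (S j)) end) H).
    cbv zeta; apply definable_or; apply definable_and.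
    + exact (definable_assign (fun i => match i with O => inl O
                                   | S j => inl (S j) end) H).
    + apply (definable_all (fun v y => P (fun n => v (S n)) y -> v 0 = y)).
      apply definable_imp; [exact H' | definability].
    + apply definable_not.
      apply (definable_ex_unique (fun v => P (fun n => v (S n)))); exact H'.
    + definability.
Qed.

(** Named before its existence is known: definability then follows from the defining predicate
    alone, and the axioms are needed only for the membership lemmas. *)
Definition setof P : M := the (fun b => forall x, x ∈ b <-> P x).

Lemma in_setof P : (exists b, forall x, x ∈ b <-> P x) ->
  forall x, x ∈ setof P <-> P x.
Proof.
  intros [b Hb]; apply (the_spec (fun b => forall x, x ∈ b <-> P x)).
  exists b; split; [exact Hb|].
  intros c Hc; apply (zf_extensionality HZF); intros x; rewrite Hb, Hc; tauto.
Qed.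

Lemma definable_setof (P : (nat -> M) -> M -> Prop) :
  definable (fun v => P (fun n => v (S n)) (v 0)) ->
  definable_term (fun v => setof (P v)).
Proof.
  intros H; apply (definable_the (fun v b => forall x, x ∈ b <-> P v x)).
  apply (definable_all (fun v x => x ∈ v 0 <-> P (fun n => v (S n)) x)).
  apply definable_iff; [definability|].
  exact (definable_assign (fun i => match i with O => inl O
                                   | S j => inl (S (S j)) end) H).
Qed.

Lemma ext a b : (forall x, x ∈ a <-> x ∈ b) -> a = b.
Proof. apply (zf_extensionality HZF). Qed.

Lemma subset_antisym a b : subset a b -> subset b a -> a = b.
Proof. intros H K; apply ext; split; auto. Qed.

Definition upair x y : M := setof (fun z => z = x \/ z = y).
Definition Union a : M := setof (fun x => exists b, b ∈ a /\ x ∈ b).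
Definition cup a b : M := setof (fun x => x ∈ a \/ x ∈ b).
Definition add x a : M := setof (fun z => z ∈ a \/ z = x).
Definition power a : M := setof (fun b => subset b a).
Definition sep a P : M := setof (fun x => x ∈ a /\ P x).
Definition image a F : M := setof (fun y => exists x, x ∈ a /\ y = F x).
Definition empty : M := setof (fun _ => False).
Definition opair x y : M := upair (upair x x) (upair x y).
Definition app f x : M := the (fun y => rel f x y).

Lemma in_upair x y z : z ∈ upair x y <-> z = x \/ z = y.
Proof. unfold upair; apply in_setof, (zf_pairing HZF). Qed.

Lemma in_Union a x : x ∈ Union a <-> exists b, b ∈ a /\ x ∈ b.
Proof. revert x; apply in_setof, (zf_union HZF). Qed.

Lemma in_cup a b x : x ∈ cup a b <-> x ∈ a \/ x ∈ b.
Proof.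
  revert x; apply in_setof; exists (Union (upair a b)); intros x; rewrite in_Union.
  split.
  - intros (c & Hc & Hx); apply in_upair in Hc as [-> | ->]; auto.
  - intros [H|H]; [exists a | exists b]; rewrite in_upair; auto.
Qed.

Lemma in_add x a z : z ∈ add x a <-> z ∈ a \/ z = x.
Proof.
  revert z; apply in_setof; exists (cup a (upair x x)); intros z.
  rewrite in_cup, in_upair; tauto.
Qed.

Lemma in_power a b : b ∈ power a <-> subset b a.
Proof. revert b; apply in_setof, (zf_power HZF). Qed.

Lemma in_sep a P : definable (fun v => P (v 0)) ->
  forall x, x ∈ sep a P <-> x ∈ a /\ P x.
Proof.
  intros (phi & r & H); apply in_setof.
  destruct (sat_pull r (fun _ => a) phi) as (psi & w & E).
  destruct (zf_separation HZF psi w a) as [b Hb].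
  exists b; intros x; rewrite Hb, <- E, <- (H (scons x _)); reflexivity.
Qed.

Lemma in_image a F : definable_term (fun v => F (v 0)) ->
  forall y, y ∈ image a F <-> exists x, x ∈ a /\ y = F x.
Proof.
  intros (phi & r & H); apply in_setof.
  destruct (sat_pull2 r (fun _ => a) phi) as (psi & w & E).
  destruct (zf_replacement HZF (phi := psi) (v := w) (a := a)) as [b Hb].
  - intros x y z _ Hy Hz; apply E, H in Hy, Hz; simpl in Hy, Hz.
    rewrite Hy, Hz; reflexivity.
  - exists b; intros y; rewrite Hb; split; intros (x & Hx & K);
      exists x; split; auto; apply E, H in K || apply E, H; exact K.
Qed.

Lemma definable_term_app1 F (s : (nat -> M) -> M) :
  definable_term (fun v => F (v 0)) -> definable_term s ->
  definable_term (fun v => F (s v)).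
Proof.
  intros H Hs; apply (definable_app2 (fun z x => z = F x)
    (s := fun v => v 0) (t := fun v => s (fun n => v (S n)))).
  - exact H.
  - apply definable_term_var.
  - exact (definable_term_shift Hs).
Qed.

Lemma definable_term_app2 (K : M -> M -> M) (s t : (nat -> M) -> M) :
  definable_term (fun v => K (v 0) (v 1)) ->
  definable_term s -> definable_term t ->
  definable_term (fun v => K (s v) (t v)).
Proof.
  intros H Hs Ht; apply (definable_app3 (fun z x y => z = K x y)
    (s := fun v => v 0) (t := fun v => s (fun n => v (S n)))
    (u := fun v => t (fun n => v (S n)))).
  - exact H.
  - apply definable_term_var.
  - exact (definable_term_shift Hs).
  - exact (definable_term_shift Ht).
Qed.

Lemma definable_sep (s : (nat -> M) -> M) (P : (nat -> M) -> M -> Prop) :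
  definable_term s -> definable (fun v => P (fun n => v (S n)) (v 0)) ->
  definable_term (fun v => sep (s v) (P v)).
Proof.
  intros Hs H; apply (definable_setof (fun v x => x ∈ s v /\ P v x)).
  apply definable_and; [|exact H].
  apply (definable_app2 (fun x y => x ∈ y)); [definability..|].
  exact (definable_term_shift Hs).
Qed.

Lemma definable_image (s : (nat -> M) -> M) (K : (nat -> M) -> M -> M) :
  definable_term s -> definable_term (fun v => K (fun n => v (S n)) (v 0)) ->
  definable_term (fun v => image (s v) (K v)).
Proof.
  intros Hs H; apply (definable_setof (fun v y => exists x, x ∈ s v /\ y = K v x)).
  apply (definable_ex (fun v x => x ∈ s (fun n => v (S n)) /\
    v 0 = K (fun n => v (S n)) x)).
  apply definable_and.
  - apply (definable_app2 (fun x y => x ∈ y)); [definability..|].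
    exact (definable_term_shift (definable_term_shift Hs)).
  - apply (definable_app2 (fun x y => x = y)); [definability..|].
    exact (definable_assign (fun i => match i with O => inl O | S O => inl 1
       | S (S j) => inl (S (S (S j))) end) H).
Qed.

Ltac definable_binder :=
  cbv beta;
  lazymatch goal with
  | |- definable_term (fun v => the (@?P v)) => apply (@definable_the P); cbv beta
  | |- definable_term (fun v => setof (@?P v)) => apply (@definable_setof P); cbv beta
  | |- definable_term (fun v => sep (@?s v) (@?P v)) =>
      apply (@definable_sep s P); cbv beta
  | |- definable_term (fun v => image (@?s v) (@?K v)) =>
      apply (@definable_image s K); cbv beta
  | H : definable_term (fun v => ?F (v 0)) |- definable_term (fun v => ?F (@?s v)) =>
      apply (@definable_term_app1 F s H); cbv beta
  | H : definable_term (fun v => ?F (v 0) (v 1)) |-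
      definable_term (fun v => ?F (@?s v) (@?t v)) =>
      apply (@definable_term_app2 F s t H); cbv beta
  end.
Hint Extern 0 (definable_term _) => definable_binder : definable.

Lemma definable_upair s t : definable_term s -> definable_term t ->
  definable_term (fun v => upair (s v) (t v)).
Proof. apply (definable_term_app2 upair); unfold upair; definability. Qed.

Lemma definable_Union s : definable_term s -> definable_term (fun v => Union (s v)).
Proof. apply (definable_term_app1 Union); unfold Union; definability. Qed.

Lemma definable_cup s t : definable_term s -> definable_term t ->
  definable_term (fun v => cup (s v) (t v)).
Proof. apply (definable_term_app2 cup); unfold cup; definability. Qed.

Lemma definable_add s t : definable_term s -> definable_term t ->
  definable_term (fun v => add (s v) (t v)).
Proof. apply (definable_term_app2 add); unfold add; definability. Qed.

Lemma definable_power s : definable_term s -> definable_term (fun v => power (s v)).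
Proof. apply (definable_term_app1 power); unfold power; definability. Qed.
Hint Resolve definable_upair definable_Union definable_cup definable_add
  definable_power : definable.

Lemma definable_opair s t : definable_term s -> definable_term t ->
  definable_term (fun v => opair (s v) (t v)).
Proof. unfold opair; definability. Qed.

Lemma definable_app_term s t : definable_term s -> definable_term t ->
  definable_term (fun v => app (s v) (t v)).
Proof. apply (definable_term_app2 app); unfold app; definability. Qed.
Hint Resolve definable_opair definable_app_term : definable.

Unset Strict Implicit.

Lemma in_empty x : ~ x ∈ empty.
Proof.
  destruct (zf_infinity HZF) as [a [(e & He & _) _]].
  enough (E : forall z, z ∈ empty <-> False) by (intros H; apply (E x), H).
  apply in_setof.
  exists e; intros z; split; [apply He | tauto].
Qed.

Lemma empty_or_inhabited a : a = empty \/ exists x, x ∈ a.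
Proof.
  destruct (classic (exists x, x ∈ a)) as [H|H]; [right; exact H | left].
  apply ext; intros x; split; intros Hx; [destruct H; exists x; exact Hx|].
  destruct (in_empty Hx).
Qed.

Lemma is_upair_iff p x y : is_upair p x y <-> p = upair x y.
Proof.
  split; [intros H; apply ext; intros z; rewrite (H z), in_upair; tauto|].
  intros -> z; apply in_upair.
Qed.

Lemma upair_inj x y x' y' : upair x y = upair x' y' ->
  (x = x' /\ y = y') \/ (x = y' /\ y = x').
Proof.
  intros E.
  assert (Hx : x ∈ upair x' y') by (rewrite <- E; apply in_upair; auto).
  assert (Hy : y ∈ upair x' y') by (rewrite <- E; apply in_upair; auto).
  assert (Hx' : x' ∈ upair x y) by (rewrite E; apply in_upair; auto).
  assert (Hy' : y' ∈ upair x y) by (rewrite E; apply in_upair; auto).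
  apply in_upair in Hx, Hy, Hx', Hy'.
  intuition congruence.
Qed.

Lemma opair_inj x y x' y' : opair x y = opair x' y' -> x = x' /\ y = y'.
Proof.
  intros E; apply upair_inj in E as [[E1 E2]|[E1 E2]];
    apply upair_inj in E1, E2; intuition congruence.
Qed.

Lemma is_opair_iff p x y : is_opair p x y <-> p = opair x y.
Proof.
  unfold is_opair, opair; split.
  - intros (s & t & Hs & Ht & Hp); apply is_upair_iff in Hs, Ht, Hp; subst; auto.
  - intros ->; exists (upair x x), (upair x y); rewrite !is_upair_iff; auto.
Qed.

Lemma rel_iff f x y : rel f x y <-> opair x y ∈ f.
Proof.
  unfold rel; split.
  - intros (p & E & H); apply is_opair_iff in E; subst; exact H.
  - intros H; exists (opair x y); rewrite is_opair_iff; auto.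
Qed.

Definition prod a b : M := setof (fun p => exists x y, x ∈ a /\ y ∈ b /\ p = opair x y).

Lemma definable_prod s t : definable_term s -> definable_term t ->
  definable_term (fun v => prod (s v) (t v)).
Proof. apply (definable_term_app2 prod); unfold prod; definability. Qed.
Hint Resolve definable_prod : definable.

Lemma in_prod a b p : p ∈ prod a b <-> exists x y, x ∈ a /\ y ∈ b /\ p = opair x y.
Proof.
  revert p; apply in_setof.
  exists (Union (image a (fun x => image b (fun y => opair x y)))).
  intros p; rewrite in_Union; split.
  - intros (c & Hc & Hp); apply in_image in Hc as (x & Hx & ->); [|definability].
    apply in_image in Hp as (y & Hy & ->); [|definability]; eauto.
  - intros (x & y & Hx & Hy & ->); exists (image b (fun y => opair x y)); split.
    + apply in_image; [definability|]; eauto.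
    + apply in_image; [definability|]; eauto.
Qed.

Lemma in_prod_pair a b x y : opair x y ∈ prod a b <-> x ∈ a /\ y ∈ b.
Proof.
  rewrite in_prod; split.
  - intros (x' & y' & Hx & Hy & E); apply opair_inj in E as [-> ->]; auto.
  - intros [Hx Hy]; eauto.
Qed.

Lemma is_prod_iff c a b : is_prod c a b <-> c = prod a b.
Proof.
  unfold is_prod; split.
  - intros H; apply ext; intros p; rewrite (H p), in_prod.
    split; intros (x & y & Hx & Hy & E); exists x, y; apply is_opair_iff in E; auto.
  - intros -> p; rewrite in_prod.
    split; intros (x & y & Hx & Hy & E); exists x, y; repeat split; auto;
      apply is_opair_iff; auto.
Qed.

(** * Functions of the model *)

Lemma fun_dom f a b x y : is_fun f a b -> rel f x y -> x ∈ a /\ y ∈ b.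
Proof.
  intros [H _] K; apply rel_iff in K; apply H in K as (x' & y' & Hx & Hy & E).
  apply is_opair_iff, opair_inj in E as [-> ->]; auto.
Qed.

Lemma app_eq f a b x y : is_fun f a b -> rel f x y -> app f x = y.
Proof.
  intros Hf H; pose proof (fun_dom Hf H) as [Hx _].
  apply the_eq; [exact H|]; intros z Hz.
  destruct Hf as [_ Hf]; destruct (Hf x Hx) as (y0 & _ & Hy).
  rewrite <- (Hy z Hz), (Hy y H); reflexivity.
Qed.

Lemma rel_app f a b x : is_fun f a b -> x ∈ a -> rel f x (app f x).
Proof. intros [_ Hf] Hx; exact (the_spec (fun y => rel f x y) (Hf x Hx)). Qed.

Lemma app_in f a b x : is_fun f a b -> x ∈ a -> app f x ∈ b.
Proof. intros Hf Hx; exact (proj2 (fun_dom Hf (rel_app Hf Hx))). Qed.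

Lemma rel_app_iff f a b x y : is_fun f a b -> rel f x y <-> x ∈ a /\ y = app f x.
Proof.
  intros Hf; split.
  - intros H; split; [apply (fun_dom Hf H) | symmetry; apply (app_eq Hf H)].
  - intros [Hx ->]; apply (rel_app Hf Hx).
Qed.

Lemma is_fun_intro f a b :
  (forall p, p ∈ f -> exists x y, x ∈ a /\ y ∈ b /\ p = opair x y) ->
  (forall x, x ∈ a -> exists y, rel f x y) ->
  (forall x y z, rel f x y -> rel f x z -> y = z) -> is_fun f a b.
Proof.
  intros H1 H2 H3; split.
  - intros p Hp; destruct (H1 p Hp) as (x & y & K); exists x, y.
    rewrite is_opair_iff; exact K.
  - intros x Hx; destruct (H2 x Hx) as [y Hy]; exists y; split; [exact Hy|].
    intros z; apply H3; exact Hy.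
Qed.

Lemma fun_ext f g a b b' : is_fun f a b -> is_fun g a b' ->
  (forall x, x ∈ a -> app f x = app g x) -> f = g.
Proof.
  assert (K : forall f g b b', is_fun f a b -> is_fun g a b' ->
    (forall x, x ∈ a -> app f x = app g x) -> subset f g).
  { intros h k c c' Hh Hk E p Hp; destruct Hh as [H1 H2].
    destruct (H1 p Hp) as (x & y & Hx & Hy & Ep); apply is_opair_iff in Ep as ->.
    apply rel_iff; apply (rel_app_iff _ _ Hk); split; auto.
    rewrite <- (E x Hx); symmetry; apply (app_eq (conj H1 H2)), rel_iff, Hp. }
  intros Hf Hg E; apply subset_antisym; [eapply K | eapply K]; eauto.
  intros; symmetry; auto.
Qed.

Lemma app_injective f a b : is_fun f a b ->
  injective f <-> (forall x y, x ∈ a -> y ∈ a -> app f x = app f y -> x = y).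
Proof.
  intros Hf; split.
  - intros H x y Hx Hy E; apply (H x y (app f x)); [|rewrite E]; apply (rel_app Hf);
      assumption.
  - intros H x y z Hx Hy; apply H; try apply (fun_dom Hf Hx) || apply (fun_dom Hf Hy).
    rewrite (app_eq Hf Hx), (app_eq Hf Hy); reflexivity.
Qed.

Definition graph a F : M := image a (fun x => opair x (F x)).

Lemma definable_graph (s : (nat -> M) -> M) (K : (nat -> M) -> M -> M) :
  definable_term s -> definable_term (fun v => K (fun n => v (S n)) (v 0)) ->
  definable_term (fun v => graph (s v) (K v)).
Proof.
  intros Hs H; apply (definable_image (fun v x => opair x (K v x)));
    definability.
Qed.

Lemma rel_graph a F : definable_term (fun v => F (v 0)) ->
  forall x y, rel (graph a F) x y <-> x ∈ a /\ y = F x.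
Proof.
  intros HF x y; unfold graph; rewrite rel_iff, in_image; [|definability]; split.
  - intros (x' & Hx & E); apply opair_inj in E as [-> ->]; auto.
  - intros [Hx ->]; eauto.
Qed.

Lemma graph_is_fun a b F : definable_term (fun v => F (v 0)) ->
  (forall x, x ∈ a -> F x ∈ b) -> is_fun (graph a F) a b.
Proof.
  intros HF H; apply is_fun_intro.
  - intros p Hp; apply in_image in Hp as (x & Hx & ->); [|definability].
    exists x, (F x); auto.
  - intros x Hx; exists (F x); apply rel_graph; auto.
  - intros x y z Hy Hz; apply rel_graph in Hy as [_ ->], Hz as [_ ->]; auto.
Qed.

Lemma app_graph a F x : definable_term (fun v => F (v 0)) -> x ∈ a ->
  app (graph a F) x = F x.
Proof.
  intros HF Hx; apply the_eq; [apply rel_graph; auto|].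
  intros z Hz; apply rel_graph in Hz; [apply Hz | exact HF].
Qed.

Ltac definable_graph_tac :=
  cbv beta;
  lazymatch goal with
  | |- definable_term (fun v => graph (@?s v) (@?K v)) =>
      apply (@definable_graph s K); cbv beta
  end.
Hint Extern 0 (definable_term _) => definable_graph_tac : definable.

(** * Natural numbers of the model *)

Definition succ x : M := add x x.

Lemma definable_succ s : definable_term s -> definable_term (fun v => succ (s v)).
Proof. unfold succ; definability. Qed.
Hint Resolve definable_succ : definable.

Lemma in_succ x z : z ∈ succ x <-> z ∈ x \/ z = x.
Proof. apply in_add. Qed.

Lemma inductive_set_iff a :
  inductive_set a <-> empty ∈ a /\ forall x, x ∈ a -> succ x ∈ a.
Proof.
  split.
  - intros [(e & He & Ha) H]; split.
    + destruct (empty_or_inhabited e) as [<- | [x Hx]]; [exact Ha | destruct (He x Hx)].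
    + intros x Hx; destruct (H x Hx) as (z & Hz & Hza).
      replace (succ x) with z; [exact Hza|].
      apply ext; intros y; rewrite (Hz y), in_succ; tauto.
  - intros [H0 H]; split.
    + exists empty; split; [intros x; apply in_empty | exact H0].
    + intros x Hx; exists (succ x); split; [intros z; apply in_succ | auto].
Qed.

Definition omega : M := the is_omega.

Lemma omega_is_omega : is_omega omega.
Proof.
  apply (the_spec is_omega); destruct (zf_infinity HZF) as [a Ha].
  set (P := fun x => forall b, inductive_set b -> x ∈ b).
  assert (HP : definable (fun v => P (v 0))).
  { unfold P, inductive_set, is_empty, is_succ; definability. }
  assert (I : inductive_set (sep a P)).
  { apply inductive_set_iff; rewrite in_sep by exact HP; split.
    - split; [apply inductive_set_iff, Ha|].
      intros b Hb; apply inductive_set_iff, Hb.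
    - intros x; rewrite !in_sep by exact HP; intros [Hx K]; split.
      + apply inductive_set_iff in Ha; apply Ha, Hx.
      + intros b Hb; pose proof (K b Hb); apply inductive_set_iff in Hb.
        apply Hb; assumption. }
  assert (L : forall b, inductive_set b -> subset (sep a P) b).
  { intros b Hb x Hx; apply in_sep in Hx; [apply Hx, Hb | exact HP]. }
  exists (sep a P); split; [split; assumption|].
  intros w [Hw1 Hw2]; apply subset_antisym; auto.
Qed.

Lemma is_omega_eq w : is_omega w -> w = omega.
Proof.
  pose proof omega_is_omega as [H1 H2]; intros [K1 K2].
  apply subset_antisym; auto.
Qed.

Lemma empty_omega : empty ∈ omega.
Proof. apply inductive_set_iff, omega_is_omega. Qed.

Lemma succ_omega n : n ∈ omega -> succ n ∈ omega.
Proof. apply inductive_set_iff, omega_is_omega. Qed.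

Lemma omega_ind P : definable (fun v => P (v 0)) -> P empty ->
  (forall n, n ∈ omega -> P n -> P (succ n)) -> forall n, n ∈ omega -> P n.
Proof.
  intros HP H0 HS n Hn.
  enough (H : subset omega (sep omega P)) by (apply H, in_sep in Hn; tauto).
  apply omega_is_omega, inductive_set_iff; rewrite in_sep by exact HP.
  split; [split; [apply empty_omega | exact H0]|].
  intros x; rewrite !in_sep by exact HP; intros [Hx K].
  split; [apply succ_omega | apply HS]; assumption.
Qed.

(** Induction holds for definable predicates only. The goal itself becomes the predicate, so
    whatever has to vary is reverted into it beforehand. *)
Ltac omega_induction n Hn :=
  pattern n;
  match goal with |- ?P n => revert n Hn; refine (@omega_ind P _ _ _) end;
  cbv beta; [definability | | ].

Lemma omega_elements n m : n ∈ omega -> m ∈ n -> m ∈ omega.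
Proof.
  intros Hn; revert m; omega_induction n Hn.
  - intros m H; destruct (in_empty H).
  - intros n Hn IH m H; apply in_succ in H as [H | ->]; auto.
Qed.

Lemma omega_trans n k m : n ∈ omega -> k ∈ m -> m ∈ n -> k ∈ n.
Proof.
  intros Hn; revert k m; omega_induction n Hn.
  - intros k m _ H; destruct (in_empty H).
  - intros n Hn IH k m Hk H; apply in_succ; apply in_succ in H as [H | ->]; eauto.
Qed.

Lemma omega_irrefl n : n ∈ omega -> ~ n ∈ n.
Proof.
  intros Hn; omega_induction n Hn; [apply in_empty|].
  intros n Hn IH H; apply IH; apply in_succ in H as [H|H].
  - apply (omega_trans Hn (m := succ n)); [apply in_succ; auto | exact H].
  - rewrite <- H at 2; apply in_succ; auto.
Qed.

Lemma empty_or_empty_in n : n ∈ omega -> n = empty \/ empty ∈ n.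
Proof.
  intros Hn; omega_induction n Hn; [auto|].
  intros n Hn [-> | H]; right; apply in_succ; auto.
Qed.

Lemma succ_monotone n m : n ∈ omega -> m ∈ n -> succ m ∈ succ n.
Proof.
  intros Hn; revert m; omega_induction n Hn.
  - intros m H; destruct (in_empty H).
  - intros n Hn IH m H; apply in_succ; apply in_succ in H as [H | ->]; auto.
Qed.

Lemma omega_total n m : n ∈ omega -> m ∈ omega -> n ∈ m \/ n = m \/ m ∈ n.
Proof.
  intros Hn; revert m; omega_induction n Hn.
  - intros m Hm; destruct (empty_or_empty_in Hm); auto.
  - intros n Hn IH m Hm; destruct (IH m Hm) as [H|[H|H]].
    + apply succ_monotone in H; [|exact Hm]; apply in_succ in H; tauto.
    + subst; right; right; apply in_succ; auto.
    + right; right; apply in_succ; auto.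
Qed.

(** Foundation gives an element minimal for membership, and the elements of a natural number are the
    smaller ones. *)
Lemma omega_least P : definable (fun v => P (v 0)) ->
  (exists n, n ∈ omega /\ P n) ->
  exists n, n ∈ omega /\ P n /\ forall m, m ∈ n -> ~ P m.
Proof.
  intros HP (n & Hn & H).
  destruct (zf_foundation HZF (a := sep omega P)) as (m & Hm & K).
  - exists n; apply in_sep; auto.
  - apply in_sep in Hm as [Hm Pm]; [|exact HP].
    exists m; repeat split; auto.
    intros k Hk Pk; apply (K k Hk), in_sep; [exact HP|].
    split; [apply (omega_elements Hm Hk) | exact Pk].
Qed.

(** * Finite sets *)

Lemma finite_iff a : finite a <-> exists n, n ∈ omega /\ equipotent a n.
Proof.
  split.
  - intros (w & n & Hw & H); apply is_omega_eq in Hw as ->; eauto.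
  - intros (n & H); exists omega, n; split; [apply omega_is_omega | exact H].
Qed.

Lemma finite_empty : finite empty.
Proof.
  apply finite_iff; exists empty; split; [apply empty_omega|].
  assert (E : forall x y, ~ rel empty x y).
  { intros x y H; apply rel_iff, in_empty in H; exact H. }
  exists empty; repeat split.
  - intros p H; destruct (in_empty H).
  - intros x H; destruct (in_empty H).
  - intros x x' y H; destruct (E _ _ H).
  - intros y H; destruct (in_empty H).
Qed.

Lemma add_in x a : x ∈ a -> add x a = a.
Proof. intros H; apply ext; intros z; rewrite in_add; intuition congruence. Qed.

Lemma finite_add x a : finite a -> finite (add x a).
Proof.
  destruct (classic (x ∈ a)) as [Hx|Hx]; [rewrite add_in; auto|].
  rewrite !finite_iff; intros (n & Hn & f & Hf & Hi & Hs).
  exists (succ n); split; [apply succ_omega, Hn|].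
  assert (R : forall y z, rel (add (opair x n) f) y z <->
    rel f y z \/ (y = x /\ z = n)).
  { intros y z; rewrite !rel_iff, in_add; split; intros [H|H]; auto.
    - apply opair_inj in H; auto.
    - destruct H as [-> ->]; auto. }
  exists (add (opair x n) f); split; [|split].
  - apply is_fun_intro.
    + intros p Hp; apply in_add in Hp as [Hp | ->].
      * apply Hf in Hp as (y & z & Hy & Hz & E); apply is_opair_iff in E.
        exists y, z; rewrite in_add, in_succ; auto.
      * exists x, n; rewrite in_add, in_succ; auto.
    + intros y Hy; apply in_add in Hy as [Hy | ->].
      * exists (app f y); apply R; left; apply (rel_app Hf Hy).
      * exists n; apply R; auto.
    + intros y z z' Hz Hz'; apply R in Hz as [Hz|[-> ->]], Hz' as [Hz'|[E ->]]; subst.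
      * rewrite <- (app_eq Hf Hz), <- (app_eq Hf Hz'); auto.
      * destruct Hx; apply (fun_dom Hf Hz).
      * destruct Hx; apply (fun_dom Hf Hz').
      * reflexivity.
  - intros y y' z Hy Hy'; apply R in Hy as [Hy|[-> ->]], Hy' as [Hy'|[-> E]]; subst.
    + apply (Hi _ _ _ Hy Hy').
    + destruct (omega_irrefl Hn); apply (fun_dom Hf Hy).
    + destruct (omega_irrefl Hn); apply (fun_dom Hf Hy').
    + reflexivity.
  - intros z Hz; apply in_succ in Hz as [Hz | ->].
    + destruct (Hs z Hz) as [y Hy]; exists y; apply R; auto.
    + exists x; apply R; auto.
Qed.

(** Induction on the cardinality, for all sets of that size at once: the element that the bijection
    sends to the last index is removed. *)
Lemma finite_ind P : definable (fun v => P (v 0)) -> P empty ->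
  (forall a x, finite a -> P a -> ~ x ∈ a -> P (add x a)) ->
  forall a, finite a -> P a.
Proof.
  intros HP H0 HS a Ha; apply finite_iff in Ha as (n & Hn & Ha).
  revert a Ha; omega_induction n Hn.
  - intros a (f & Hf & _).
    destruct (empty_or_inhabited a) as [-> | [x Hx]]; [exact H0|].
    destruct (in_empty (app_in Hf Hx)).
  - intros n Hn IH a (f & Hf & Hi & Hs).
    destruct (Hs n) as [x Hx]; [apply in_succ; auto|].
    set (b := sep a (fun y => app f y ∈ n)).
    assert (Hb : forall y, y ∈ b <-> y ∈ a /\ app f y ∈ n).
    { apply in_sep; definability. }
    assert (E : equipotent b n).
    { exists (graph b (fun y => app f y)).
      assert (D : definable_term (fun v => app f (v 0))) by definability.
      split; [|split].
      - apply graph_is_fun; [exact D|]; intros y Hy; apply Hb, Hy.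
      - intros y y' z Hy Hy'; apply rel_graph in Hy as [Hy ->], Hy' as [Hy' E]; auto.
        apply Hb in Hy as [Hy _], Hy' as [Hy' _].
        apply (proj1 (app_injective Hf) Hi); auto.
      - intros z Hz; destruct (Hs z) as [y Hy]; [apply in_succ; auto|].
        exists y; apply rel_graph; [exact D|].
        apply (rel_app_iff _ _ Hf) in Hy as [Hy ->]; rewrite Hb; auto. }
    apply (rel_app_iff _ _ Hf) in Hx as [Hx En].
    replace a with (add x b).
    + apply HS; [apply finite_iff; eauto | apply IH, E |].
      rewrite Hb, <- En; intros [_ H]; apply (omega_irrefl Hn H).
    + apply ext; intros y; rewrite in_add, Hb; split.
      * intros [[Hy _] | ->]; auto.
      * intros Hy; pose proof (app_in Hf Hy) as K.
        apply in_succ in K as [K|K]; [auto|right].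
        apply (proj1 (app_injective Hf) Hi); congruence.
Qed.

Ltac finite_induction a Ha :=
  pattern a;
  match goal with |- ?P a => revert a Ha; refine (@finite_ind P _ _ _) end;
  cbv beta; [definability | | ].

Lemma finite_subset a b : finite a -> subset b a -> finite b.
Proof.
  intros Ha; revert b; finite_induction a Ha.
  - intros b H; destruct (empty_or_inhabited b) as [-> | [x Hx]].
    + apply finite_empty.
    + destruct (in_empty (H x Hx)).
  - intros a x _ IH _ b H.
    assert (D : forall y, y ∈ sep b (fun y => y <> x) <-> y ∈ b /\ y <> x)
      by (apply in_sep; definability).
    assert (Hf : finite (sep b (fun y => y <> x))).
    { apply IH; intros y Hy; apply D in Hy as [Hy K].
      apply H, in_add in Hy; tauto. }
    destruct (classic (x ∈ b)) as [Hx|Hx].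
    + replace b with (add x (sep b (fun y => y <> x))); [apply finite_add, Hf|].
      apply ext; intros y; rewrite in_add, D.
      destruct (classic (y = x)); intuition congruence.
    + apply IH; intros y Hy; pose proof (H y Hy) as K; apply in_add in K.
      intuition congruence.
Qed.

Lemma finite_cup a b : finite a -> finite b -> finite (cup a b).
Proof.
  intros Ha Hb; finite_induction b Hb.
  - apply (finite_subset Ha); intros x Hx; apply in_cup in Hx as [Hx|Hx]; auto.
    destruct (in_empty Hx).
  - intros b x _ IH _; apply (finite_subset (finite_add x IH)).
    intros y; rewrite in_add, !in_cup, in_add; tauto.
Qed.

Lemma finite_image a F : definable_term (fun v => F (v 0)) ->
  finite a -> finite (image a F).
Proof.
  intros HF Ha; finite_induction a Ha.
  - apply (finite_subset finite_empty); intros y Hy.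
    apply in_image in Hy as (x & Hx & _); [destruct (in_empty Hx) | exact HF].
  - intros a x _ IH _; apply (finite_subset (finite_add (F x) IH)).
    intros y; rewrite in_add, !in_image by exact HF.
    intros (z & Hz & ->); apply in_add in Hz as [Hz | ->]; eauto.
Qed.

Lemma finite_Union a : finite a -> (forall b, b ∈ a -> finite b) -> finite (Union a).
Proof.
  intros Ha; finite_induction a Ha.
  - intros _; apply (finite_subset finite_empty); intros x Hx.
    apply in_Union in Hx as (b & Hb & _); destruct (in_empty Hb).
  - intros a b _ IH _ H; apply (finite_subset (a := cup (Union a) b)).
    + apply finite_cup; [apply IH; intros c Hc; apply H | apply H]; apply in_add; auto.
    + intros x Hx; apply in_Union in Hx as (c & Hc & Hx); apply in_cup.
      apply in_add in Hc as [Hc | ->]; [left; apply in_Union; eauto | auto].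
Qed.

Lemma finite_power a : finite a -> finite (power a).
Proof.
  intros Ha; finite_induction a Ha.
  - apply (finite_subset (finite_add empty finite_empty)).
    intros b Hb; apply in_power in Hb; apply in_add; right.
    destruct (empty_or_inhabited b) as [H | [x Hx]]; [exact H|].
    destruct (in_empty (Hb x Hx)).
  - intros a x _ IH _.
    apply (finite_subset (a := cup (power a) (image (power a) (add x)))).
    + apply finite_cup, finite_image; [exact IH | definability | exact IH].
    + intros b Hb; apply in_power in Hb; apply in_cup.
      assert (D : forall y, y ∈ sep b (fun y => y <> x) <-> y ∈ b /\ y <> x)
        by (apply in_sep; definability).
      destruct (classic (x ∈ b)) as [Hx|Hx].
      * right; apply in_image; [definability|].
        exists (sep b (fun y => y <> x)); split.
        -- apply in_power; intros y Hy; apply D in Hy as [Hy K].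
           apply Hb, in_add in Hy; tauto.
        -- apply ext; intros y; rewrite in_add, D.
           destruct (classic (y = x)); intuition congruence.
      * left; apply in_power; intros y Hy; pose proof (Hb y Hy) as K.
        apply in_add in K; intuition congruence.
Qed.

Lemma finite_prod a b : finite a -> finite b -> finite (prod a b).
Proof.
  intros Ha Hb; finite_induction a Ha.
  - apply (finite_subset finite_empty); intros p Hp.
    apply in_prod in Hp as (x & y & Hx & _); destruct (in_empty Hx).
  - intros a x _ IH _.
    apply (finite_subset (a := cup (prod a b) (image b (opair x)))).
    + apply finite_cup, finite_image; [exact IH | definability | exact Hb].
    + intros p Hp; apply in_prod in Hp as (z & y & Hz & Hy & ->); apply in_cup.
      apply in_add in Hz as [Hz | ->]; [left; apply in_prod_pair; auto|].
      right; apply in_image; [definability | eauto].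
Qed.

(** * Linear orders *)

Record linear_order (lt : M -> M -> Prop) (S : M) : Prop := {
  lt_irrefl : forall x, x ∈ S -> ~ lt x x;
  lt_trans : forall x y z, x ∈ S -> y ∈ S -> z ∈ S -> lt x y -> lt y z -> lt x z;
  lt_total : forall x y, x ∈ S -> y ∈ S -> lt x y \/ x = y \/ lt y x
}.

Arguments lt_total {lt S} _ x y _ _.

Lemma linear_order_subset lt A B :
  linear_order lt B -> subset A B -> linear_order lt A.
Proof. intros [H1 H2 H3] H; split; eauto. Qed.

Lemma linear_order_flip lt A :
  linear_order lt A -> linear_order (fun x y => lt y x) A.
Proof.
  intros [H1 H2 H3]; split; eauto.
  intros x y Hx Hy; destruct (H3 x y Hx Hy) as [H|[H|H]]; auto.
Qed.

Lemma linear_order_preimage lt A B (K : M -> M) :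
  linear_order lt B -> (forall x, x ∈ A -> K x ∈ B) ->
  (forall x y, x ∈ A -> y ∈ A -> K x = K y -> x = y) ->
  linear_order (fun x y => lt (K x) (K y)) A.
Proof.
  intros [H1 H2 H3] H I; split; eauto.
  intros x y Hx Hy; destruct (H3 (K x) (K y)) as [E|[E|E]]; auto.
Qed.

Lemma definable_linear_order s t : definable_term s -> definable_term t ->
  definable (fun v => linear_order (rel (s v)) (t v)).
Proof.
  apply (definable_app2 (fun r a => linear_order (rel r) a)).
  apply definable_ext with (Q := fun v =>
    (forall x, x ∈ v 1 -> ~ rel (v 0) x x) /\
    (forall x y z, x ∈ v 1 -> y ∈ v 1 -> z ∈ v 1 ->
      rel (v 0) x y -> rel (v 0) y z -> rel (v 0) x z) /\
    (forall x y, x ∈ v 1 -> y ∈ v 1 -> rel (v 0) x y \/ x = y \/ rel (v 0) y x)).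
  - intros v; split; [intros [H1 H2 H3]; auto | intros (H1 & H2 & H3); split; auto].
  - definability.
Qed.
Hint Resolve definable_linear_order : definable.

Definition is_least (lt : M -> M -> Prop) (a m : M) : Prop :=
  m ∈ a /\ forall x, x ∈ a -> x <> m -> lt m x.

Lemma is_least_unique lt A a x y : linear_order lt A -> subset a A ->
  is_least lt a x -> is_least lt a y -> x = y.
Proof.
  intros H Ha [Hx Kx] [Hy Ky]; apply NNPP; intros N.
  apply (lt_irrefl H (x := x)); auto.
  apply (lt_trans H (y := y)); auto.
Qed.

Lemma finite_least lt A a : definable (fun v => lt (v 0) (v 1)) ->
  linear_order lt A -> finite a -> subset a A -> nonempty a ->
  exists m, is_least lt a m.
Proof.
  intros Hlt HA Ha; unfold is_least; finite_induction a Ha.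
  - intros _ [x Hx]; destruct (in_empty Hx).
  - intros a x _ IH Hx Hs _.
    destruct (empty_or_inhabited a) as [-> | Hne].
    + exists x; rewrite in_add; split; [auto|]; intros y Hy N.
      apply in_add in Hy as [Hy | ->]; [destruct (in_empty Hy) | tauto].
    + assert (Hsa : subset a A) by (intros y Hy; apply Hs, in_add; auto).
      destruct (IH Hsa Hne) as (m & Hm & K).
      assert (HxA : x ∈ A) by (apply Hs, in_add; auto).
      destruct (lt_total HA x m HxA (Hsa m Hm)) as [L|[<- | L]]; [| tauto |].
      * exists x; rewrite in_add; split; [auto|]; intros y Hy N.
        apply in_add in Hy as [Hy | ->]; [|tauto].
        destruct (classic (y = m)) as [-> | N']; [exact L|].
        apply (lt_trans HA (y := m)); auto.
      * exists m; rewrite in_add; split; [auto|]; intros y Hy N.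
        apply in_add in Hy as [Hy | ->]; auto.
Qed.

(** A new element is put on top. With [r] inside [prod a a], the orders of a finite set lie in a
    finite power set, so they form a finite set from which [CAC_fin] can choose. *)
Lemma finite_order a : finite a ->
  exists r, subset r (prod a a) /\ linear_order (rel r) a.
Proof.
  intros Ha; finite_induction a Ha.
  - exists empty; split; [intros p Hp; destruct (in_empty Hp)|].
    split; intros x; intros; match goal with H : _ ∈ empty |- _ =>
      destruct (in_empty H) end.
  - intros a x _ (r & Hr & [H1 H2 H3]) Hx.
    exists (cup r (image a (fun y => opair y x))).
    assert (R : forall y z, rel (cup r (image a (fun y => opair y x))) y z <->
      rel r y z \/ (y ∈ a /\ z = x)).
    { intros y z; rewrite !rel_iff, in_cup, in_image by definability.
      split; intros [H|H]; auto.
      - destruct H as (y' & Hy & E); apply opair_inj in E as [-> ->]; auto.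
      - destruct H as [Hy ->]; eauto. }
    assert (Hra : forall y z, rel r y z -> y ∈ a /\ z ∈ a).
    { intros y z H; apply rel_iff, Hr, in_prod_pair in H; exact H. }
    split; [|split].
    + intros p Hp; apply in_cup in Hp as [Hp|Hp].
      * apply Hr, in_prod in Hp as (y & z & Hy & Hz & ->).
        apply in_prod_pair; rewrite !in_add; auto.
      * apply in_image in Hp as (y & Hy & ->); [|definability].
        apply in_prod_pair; rewrite !in_add; auto.
    + intros y Hy H; apply R in H as [H|[H ->]]; [|tauto].
      apply (H1 y); [apply (Hra _ _ H) | exact H].
    + intros y z w _ _ _ H K; apply R in H as [H|[H ->]], K as [K|[K ->]];
        apply R; try tauto.
      * pose proof (Hra _ _ H); pose proof (Hra _ _ K); left; eapply H2; eauto; tauto.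
      * pose proof (Hra _ _ H); tauto.
      * destruct Hx; apply (Hra _ _ K).
    + intros y z Hy Hz; rewrite !R; apply in_add in Hy as [Hy | ->], Hz as [Hz | ->].
      * destruct (H3 y z Hy Hz) as [K|[K|K]]; auto.
      * auto.
      * auto.
      * auto.
Qed.

(** * Recursion and countability *)

(** The graph of the recursive function is the least set of pairs that contains
    (0, b) and is closed under (n, y) |-> (n + 1, G y). *)
Lemma recursion B b G : definable_term (fun v => G (v 0)) ->
  b ∈ B -> (forall x, x ∈ B -> G x ∈ B) ->
  exists f, is_fun f omega B /\ app f empty = b /\
    forall n, n ∈ omega -> app f (succ n) = G (app f n).
Proof.
  intros HG Hb HB.
  set (closed := fun z => opair empty b ∈ z /\ forall n y,
    n ∈ omega -> y ∈ B -> opair n y ∈ z -> opair (succ n) (G y) ∈ z).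
  set (f := sep (prod omega B) (fun p => forall z, closed z -> p ∈ z)).
  assert (Hf : forall p, p ∈ f <-> p ∈ prod omega B /\ forall z, closed z -> p ∈ z).
  { apply in_sep; unfold closed; definability. }
  assert (C : closed f).
  { split.
    - apply Hf; split; [apply in_prod_pair; auto using empty_omega|].
      intros z [Hz _]; exact Hz.
    - intros n y Hn Hy K; apply Hf in K as [_ K]; apply Hf; split.
      + apply in_prod_pair; auto using succ_omega.
      + intros z Hz; pose proof (K z Hz) as Kz; destruct Hz as [_ Hz].
        exact (Hz n y Hn Hy Kz). }
  destruct C as [C0 CS].
  assert (D : forall q p, p ∈ sep f (fun p => p <> q) <-> p ∈ f /\ p <> q).
  { intros q; apply in_sep; definability. }
  (* A pair with another value could be deleted from the least closed set without destroying
     closure; so values are unique, here and then at successors. *)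
  assert (H0 : forall y, opair empty y ∈ f -> y = b).
  { intros y Hy; apply NNPP; intros N.
    assert (K : closed (sep f (fun p => p <> opair empty y))).
    { split.
      - apply D; split; [exact C0|]; intros E; apply opair_inj in E as [_ E]; auto.
      - intros n w Hn Hw H; apply D in H as [H _]; apply D.
        split; [exact (CS n w Hn Hw H)|].
        intros E; apply opair_inj in E as [E _].
        apply (@in_empty n); rewrite <- E; apply in_succ; auto. }
    apply Hf in Hy as [_ Hy]; apply (Hy _), D in K; tauto. }
  assert (HS : forall n y, n ∈ omega -> (forall w, opair n w ∈ f -> w = y) ->
    forall w, opair (succ n) w ∈ f -> w = G y).
  { intros n y Hn Hu w Hw; apply NNPP; intros N.
    assert (K : closed (sep f (fun p => p <> opair (succ n) w))).
    { split.
      - apply D; split; [exact C0|]; intros E; apply opair_inj in E as [E _].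
        apply (@in_empty n); rewrite E; apply in_succ; auto.
      - intros k x Hk Hx H; apply D in H as [H _]; apply D.
        split; [exact (CS k x Hk Hx H)|].
        intros E; apply opair_inj in E as [E1 E2].
        (* [succ] is injective: otherwise [k] and [n] would be elements of each other, whence
           [n ∈ n]. *)
        assert (Ek : k = n).
        { assert (Hkn : k ∈ succ n) by (rewrite <- E1; apply in_succ; auto).
          assert (Hnk : n ∈ succ k) by (rewrite E1; apply in_succ; auto).
          apply in_succ in Hkn as [Hkn|Hkn]; [|exact Hkn].
          apply in_succ in Hnk as [Hnk|Hnk]; [|auto].
          destruct (omega_irrefl Hn); apply (omega_trans Hn Hnk Hkn). }
        subst k; apply Hu in H; subst x; auto. }
    apply Hf in Hw as [_ Hw]; apply (Hw _), D in K; tauto. }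
  assert (U : forall n, n ∈ omega ->
    exists y, y ∈ B /\ opair n y ∈ f /\ forall w, opair n w ∈ f -> w = y).
  { intros n Hn; omega_induction n Hn.
    - exists b; split; [exact Hb | split; [exact C0 | exact H0]].
    - intros n Hn (y & Hy & H & K); exists (G y).
      split; [auto | split; [exact (CS n y Hn Hy H) | apply HS; auto]]. }
  assert (F : is_fun f omega B).
  { apply is_fun_intro.
    - intros p Hp; apply Hf in Hp as [Hp _]; apply in_prod; exact Hp.
    - intros n Hn; destruct (U n Hn) as (y & _ & Hy & _); exists y; apply rel_iff, Hy.
    - intros n y z Hy Hz; apply rel_iff in Hy, Hz.
      assert (Hn : n ∈ omega)
        by (apply Hf in Hy as [Hy _]; apply in_prod_pair in Hy; tauto).
      destruct (U n Hn) as (w & _ & _ & K); rewrite (K _ Hy), (K _ Hz); auto. }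
  exists f; split; [exact F | split].
  - apply (app_eq F), rel_iff, C0.
  - intros n Hn; apply (app_eq F), rel_iff.
    apply (CS n _ Hn (app_in F Hn)), rel_iff, (rel_app F Hn).
Qed.

Lemma equipotent_sym a b : equipotent a b -> equipotent b a.
Proof.
  intros (f & Hf & Hi & Hs).
  set (K := fun y => the (fun x => rel f x y)).
  assert (HK : definable_term (fun v => K (v 0))) by (unfold K; definability).
  assert (E : forall x y, rel f x y -> K y = x).
  { intros x y H; apply the_eq; [exact H|]; intros z Hz; apply (Hi _ _ _ Hz H). }
  exists (graph b K); split; [|split].
  - apply graph_is_fun; [exact HK|]; intros y Hy.
    destruct (Hs y Hy) as [x Hx]; rewrite (E x y Hx); apply (fun_dom Hf Hx).
  - intros y y' x Hy Hy'; apply rel_graph in Hy as [Hy ->], Hy' as [Hy' K']; auto.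
    destruct (Hs y Hy) as [x Hx], (Hs y' Hy') as [x' Hx'].
    rewrite (E _ _ Hx), (E _ _ Hx') in K'; subst x'.
    rewrite <- (app_eq Hf Hx), <- (app_eq Hf Hx'); reflexivity.
  - intros x Hx; exists (app f x); apply rel_graph; [exact HK|].
    rewrite (E x); [|apply (rel_app Hf Hx)]; split; [apply (app_in Hf Hx) | reflexivity].
Qed.

Lemma equipotent_iff a b : equipotent a b <->
  exists f, is_fun f a b /\
    (forall x y, x ∈ a -> y ∈ a -> app f x = app f y -> x = y) /\
    (forall y, y ∈ b -> exists x, x ∈ a /\ app f x = y).
Proof.
  split; intros (f & Hf & Hi & Hs); exists f; split; auto.
  - split; [apply (app_injective Hf), Hi|].
    intros y Hy; destruct (Hs y Hy) as [x Hx]; exists x.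
    apply (rel_app_iff _ _ Hf) in Hx as [Hx ->]; auto.
  - split; [apply (app_injective Hf), Hi|].
    intros y Hy; destruct (Hs y Hy) as (x & Hx & <-); exists x; apply (rel_app Hf Hx).
Qed.

(** Finite initial segments make [lt] a well-order. If [A] is infinite, every point has an immediate
    successor, and recursion along successors from the least element reaches every point. *)
Lemma countable_of_initial_segments lt A : definable (fun v => lt (v 0) (v 1)) ->
  linear_order lt A -> (forall x, x ∈ A -> finite (sep A (fun y => lt y x))) ->
  countable A.
Proof.
  intros Hlt HA Hfin.
  destruct (classic (finite A)) as [F|NF]; [left; exact F | right].
  assert (D : forall x y, y ∈ sep A (fun y => lt y x) <-> y ∈ A /\ lt y x).
  { intros x; apply in_sep; definability. }
  assert (W : forall a, subset a A -> nonempty a -> exists m, is_least lt a m).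
  { intros a Ha [x Hx].
    assert (Ds : forall y, y ∈ sep a (fun y => lt y x) <-> y ∈ a /\ lt y x).
    { apply in_sep; definability. }
    destruct (empty_or_inhabited (sep a (fun y => lt y x))) as [E | Hne].
    - exists x; split; [exact Hx|]; intros y Hy N.
      destruct (lt_total HA x y) as [L|[L|L]]; auto; [congruence|].
      destruct (@in_empty y); rewrite <- E; apply Ds; auto.
    - destruct (@finite_least lt A (sep a (fun y => lt y x)) Hlt HA) as (m & Hm & K).
      + apply (finite_subset (Hfin x (Ha x Hx))); intros y Hy; apply Ds in Hy.
        apply D; split; [apply Ha|]; apply Hy.
      + intros y Hy; apply Ha; apply Ds in Hy; apply Hy.
      + exact Hne.
      + apply Ds in Hm as [Hm L]; exists m; split; [exact Hm|]; intros y Hy N.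
        destruct (lt_total HA y x) as [Ly|[-> | Ly]]; auto.
        * apply K; [apply Ds; auto | exact N].
        * apply (lt_trans HA (y := x)); auto. }
  set (above := fun x => sep A (fun y => lt x y)).
  assert (Da : forall x y, y ∈ above x <-> y ∈ A /\ lt x y).
  { intros x; apply in_sep; definability. }
  set (G := fun x => the (fun m => is_least lt (above x) m)).
  assert (HG : definable_term (fun v => G (v 0))).
  { unfold G, is_least, above; definability. }
  assert (HGl : forall x, x ∈ A -> is_least lt (above x) (G x)).
  { intros x Hx; unfold G; apply (the_spec (fun m => is_least lt (above x) m)).
    assert (Hs : subset (above x) A) by (intros y Hy; apply Da in Hy; apply Hy).
    destruct (W (above x) Hs) as [m Hm].
    (* If nothing were above [x], then [A] would be the finite segment below [x] together with
       [x]. *)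
    - apply NNPP; intros N; apply NF.
      apply (finite_subset (finite_add x (Hfin x Hx))); intros y Hy.
      apply in_add; rewrite D; destruct (lt_total HA x y) as [L|[L|L]]; auto.
      destruct N; exists y; apply Da; auto.
    - exists m; split; [exact Hm|]; intros z Hz; apply (is_least_unique HA Hs Hm Hz). }
  destruct (W A (fun x H => H)) as [b Hb].
  { apply NNPP; intros N; apply NF.
    destruct (empty_or_inhabited A) as [-> | H]; [apply finite_empty | tauto]. }
  destruct (@recursion A b G HG (proj1 Hb)) as (f & Hf & Hf0 & HfS).
  { intros x Hx; apply Da with (x := x), HGl, Hx. }
  assert (Step : forall n, n ∈ omega -> lt (app f n) (app f (succ n))).
  { intros n Hn; rewrite HfS by exact Hn.
    apply (Da (app f n)), HGl, (app_in Hf Hn). }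
  assert (Mono : forall m, m ∈ omega -> forall n, n ∈ m -> lt (app f n) (app f m)).
  { intros m Hm; omega_induction m Hm.
    - intros n Hn; destruct (in_empty Hn).
    - intros m Hm IH n Hn; apply in_succ in Hn as [Hn | ->]; [|auto].
      pose proof (omega_elements Hm Hn); pose proof (succ_omega Hm).
      apply (lt_trans HA (y := app f m)); auto; apply (app_in Hf); auto. }
  exists omega; split; [apply omega_is_omega|]; apply equipotent_sym, equipotent_iff.
  exists f; split; [exact Hf | split].
  - intros n m Hn Hm E; destruct (omega_total Hn Hm) as [H|[H|H]]; [|exact H|];
      apply Mono in H; auto; rewrite E in H;
      destruct (lt_irrefl HA (app_in Hf Hm) H).
  - intros x Hx; apply NNPP; intros N.
    (* A point [x] that is missed bounds all values of [f]; these then lie in a finite segment and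
       have a greatest one, which the next value exceeds. *)
    assert (L : forall n, n ∈ omega -> lt (app f n) x).
    { intros n Hn; omega_induction n Hn.
      - rewrite Hf0; apply Hb; [exact Hx|]; intros ->.
        apply N; exists empty; split; [apply empty_omega | exact Hf0].
      - intros n Hn IH; rewrite HfS by exact Hn.
        apply (HGl (app f n) (app_in Hf Hn)); [apply Da; auto|].
        intros ->; apply N; exists (succ n); auto using succ_omega. }
    set (T := image omega (app f)).
    assert (DT : forall y, y ∈ T <-> exists n, n ∈ omega /\ y = app f n).
    { apply in_image; definability. }
    assert (HT : subset T A).
    { intros y Hy; apply DT in Hy as (n & Hn & ->); apply (app_in Hf Hn). }
    destruct (@finite_least (fun y z => lt z y) A T) as (m & Hm & K).
    + definability.
    + apply linear_order_flip, HA.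
    + apply (finite_subset (Hfin x Hx)); intros y Hy; apply D; split; auto.
      apply DT in Hy as (n & Hn & ->); auto.
    + exact HT.
    + exists (app f empty); apply DT; eauto using empty_omega.
    + pose proof (HT m Hm) as HmA.
      apply DT in Hm as (n & Hn & ->).
      pose proof (Step n Hn) as HL.
      assert (Hsn : app f (succ n) ∈ T) by (apply DT; eauto using succ_omega).
      apply (lt_irrefl HA HmA), (lt_trans HA (y := app f (succ n))); auto.
      apply K; [exact Hsn|]; intros E; rewrite E in HL.
      apply (lt_irrefl HA HmA HL).
Qed.

Lemma equipotent_graph a F : definable_term (fun v => F (v 0)) ->
  (forall x y, x ∈ a -> y ∈ a -> F x = F y -> x = y) -> equipotent a (image a F).
Proof.
  intros HF Hi; apply equipotent_iff.
  assert (D : forall x, x ∈ a -> app (graph a F) x = F x)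
    by (intros; apply app_graph; auto).
  exists (graph a F); split; [|split].
  - apply graph_is_fun; [exact HF|]; intros x Hx; apply in_image; eauto.
  - intros x y Hx Hy; rewrite !D; auto.
  - intros y Hy; apply in_image in Hy as (x & Hx & ->); [|exact HF]; eauto.
Qed.

Lemma finite_omega_element n : n ∈ omega -> finite n.
Proof.
  intros Hn; omega_induction n Hn; [apply finite_empty|].
  intros n _ H; apply finite_add, H.
Qed.

(** Choosing a linear order on each [A n] orders the union lexicographically, by
    the least index first; initial segments are then finite. *)
Lemma countable_union (A : M -> M) B : CAC_fin M ->
  definable_term (fun v => A (v 0)) -> (forall n, n ∈ omega -> finite (A n)) ->
  (forall x, x ∈ B -> exists n, n ∈ omega /\ x ∈ A n) -> countable B.
Proof.
  intros CAC HA Hfin HB.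
  set (orders := fun n => sep (power (prod (A n) (A n)))
    (fun r => linear_order (rel r) (A n))).
  assert (Ho : forall n r, r ∈ orders n <->
    subset r (prod (A n) (A n)) /\ linear_order (rel r) (A n)).
  { intros n r; unfold orders; rewrite in_sep, in_power by definability; tauto. }
  assert (Dord : definable_term (fun v => orders (v 0))) by (unfold orders; definability).
  (* [A n] and [A m] may coincide; tagging each order with its index makes [K] injective, so that
     the family is denumerable. *)
  set (K := fun n => image (orders n) (opair n)).
  assert (HK : definable_term (fun v => K (v 0))) by (unfold K; definability).
  assert (InK : forall n p, p ∈ K n <-> exists r, r ∈ orders n /\ p = opair n r).
  { intros n; apply in_image; definability. }
  assert (NK : forall n, n ∈ omega -> exists r, opair n r ∈ K n).
  { intros n Hn; destruct (finite_order (Hfin n Hn)) as (r & Hr & Lr).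
    exists r; apply InK; exists r; rewrite Ho; auto. }
  destruct (CAC (image omega K)) as (u & f & Hf & Hc).
  - exists omega; split; [apply omega_is_omega|]; apply equipotent_sym.
    apply equipotent_graph; [exact HK|]; intros n m Hn Hm E.
    destruct (NK n Hn) as (r & Hr); rewrite E in Hr.
    apply InK in Hr as (r' & _ & E'); apply opair_inj in E'; tauto.
  - intros a Ha; apply in_image in Ha as (n & Hn & ->); [|exact HK]; split.
    + destruct (NK n Hn) as (r & Hr); exists (opair n r); exact Hr.
    + apply finite_image; [definability|].
      apply (finite_subset (finite_power (finite_prod (Hfin n Hn) (Hfin n Hn)))).
      intros r Hr; apply Ho in Hr; apply in_power, Hr.
  - set (ord := fun n x y => exists r, rel f (K n) (opair n r) /\ rel r x y).
    assert (Hord : forall n, n ∈ omega -> linear_order (ord n) (A n)).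
    { intros n Hn.
      assert (Hx : rel f (K n) (app f (K n))) by (apply (rel_app Hf), in_image; eauto).
      pose proof (Hc _ _ Hx) as H; apply InK in H as (r & Hr & E).
      rewrite E in Hx; apply Ho in Hr as [_ Hr].
      assert (W : forall x y, ord n x y <-> rel r x y).
      { intros x y; split; [|intros H; exists r; auto].
        intros (r' & Hr' & H); replace r with r'; [exact H|].
        apply (app_eq Hf) in Hx, Hr'; rewrite Hx in Hr'.
        apply opair_inj in Hr'; symmetry; apply Hr'. }
      destruct Hr as [H1 H2 H3]; split.
      - intros x Hx'; rewrite W; auto.
      - intros x y z Hx' Hy' Hz'; rewrite !W; eauto.
      - intros x y Hx' Hy'; rewrite !W; auto. }
    set (level := fun x n => n ∈ omega /\ x ∈ A n /\ forall m, m ∈ n -> ~ x ∈ A m).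
    set (lv := fun x => the (level x)).
    assert (Dlv : definable_term (fun v => lv (v 0))) by (unfold lv, level; definability).
    assert (Hlv : forall x, x ∈ B -> lv x ∈ omega /\ x ∈ A (lv x)).
    { intros x Hx; enough (level x (lv x)) by (unfold level in *; tauto).
      apply (the_spec (level x)).
      destruct (omega_least (P := fun n => x ∈ A n)) as (n & Hn & Hxn & L).
      - definability.
      - auto.
      - exists n; split; [split; auto|]; intros m (Hm & Hxm & L').
        destruct (omega_total Hn Hm) as [H|[H|H]]; [|exact H|].
        + destruct (L' n H Hxn).
        + destruct (L m H Hxm). }
    set (lt := fun x y => lv x ∈ lv y \/ (lv x = lv y /\ ord (lv x) x y)).
    assert (Dlt : definable (fun v => lt (v 0) (v 1))) by (unfold lt, ord; definability).
    apply (countable_of_initial_segments (lt := lt) Dlt).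
    + split; unfold lt.
      * intros x Hx H; destruct (Hlv x Hx) as [Hn Hxn].
        destruct H as [H|[_ H]]; [apply (omega_irrefl Hn H)|].
        apply (lt_irrefl (Hord _ Hn) Hxn H).
      * intros x y z Hx Hy Hz H H'.
        destruct (Hlv x Hx) as [Hn Hxn], (Hlv y Hy) as [Hm Hym], (Hlv z Hz) as [Hk Hzk].
        destruct H as [H|[E H]], H' as [H'|[E' H']].
        -- left; apply (omega_trans Hk H H').
        -- left; congruence.
        -- left; congruence.
        -- right; split; [congruence|]; rewrite E, <- E in *.
           apply (lt_trans (Hord _ Hn) (y := y)); congruence.
      * intros x y Hx Hy.
        destruct (Hlv x Hx) as [Hn Hxn], (Hlv y Hy) as [Hm Hym].
        destruct (omega_total Hn Hm) as [H|[E|H]]; auto.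
        rewrite <- E in *; destruct (lt_total (Hord _ Hn) x y Hxn Hym) as [H|[H|H]];
          auto.
    + intros x Hx; destruct (Hlv x Hx) as [Hn Hxn].
      (* [succ (lv x)] consists of the indices up to and including [lv x], the only levels at which
         predecessors of [x] occur. *)
      apply (finite_subset (a := Union (image (succ (lv x)) A))).
      * apply finite_Union; [apply finite_image, finite_omega_element, succ_omega; auto|].
        intros b Hb; apply in_image in Hb as (m & Hm & ->); [|exact HA].
        apply Hfin, (omega_elements (succ_omega Hn) Hm).
      * intros y Hy; apply in_sep in Hy as [Hy L]; [|definability].
        apply in_Union; exists (A (lv y)); split; [|apply Hlv, Hy].
        apply in_image; [exact HA|]; exists (lv y); split; [|reflexivity].
        apply in_succ; destruct L as [L|[L _]]; auto.
Qed.

Lemma countable_injection a : countable a ->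
  exists j, is_fun j a omega /\
    (forall x y, x ∈ a -> y ∈ a -> app j x = app j y -> x = y).
Proof.
  intros H; assert (K : exists n, subset n omega /\ equipotent a n).
  { destruct H as [H|(w & Hw & H)].
    - apply finite_iff in H as (n & Hn & H); exists n; split; [|exact H].
      intros m; apply omega_elements, Hn.
    - apply is_omega_eq in Hw as ->; exists omega; split; [intros m Hm|]; auto. }
  destruct K as (n & Hn & K); apply equipotent_iff in K as (j & Hj & Hi & _).
  exists j; split; [|exact Hi]; apply is_fun_intro.
  - intros p Hp; apply Hj in Hp as (x & y & Hx & Hy & E).
    apply is_opair_iff in E; exists x, y; auto.
  - intros x Hx; exists (app j x); apply (rel_app Hj Hx).
  - intros x y z Hy Hz; rewrite <- (app_eq Hj Hy), <- (app_eq Hj Hz); reflexivity.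
Qed.

(** * Real numbers of the model *)

Definition app2 f x y : M := app f (opair x y).

Lemma definable_app2_term s t (u : (nat -> M) -> M) :
  definable_term s -> definable_term t -> definable_term u ->
  definable_term (fun v => app2 (s v) (t v) (u v)).
Proof. unfold app2; definability. Qed.
Hint Resolve definable_app2_term : definable.

Lemma op_iff f a b c x y z : is_fun2 f a b c ->
  op f x y z <-> x ∈ a /\ y ∈ b /\ z = app2 f x y.
Proof.
  intros (p & Hp & Hf); apply is_prod_iff in Hp as ->; unfold op, app2; split.
  - intros (q & Hq & H); apply is_opair_iff in Hq as ->.
    apply (rel_app_iff _ _ Hf) in H as [H ->]; apply in_prod_pair in H; tauto.
  - intros (Hx & Hy & ->); exists (opair x y); split; [apply is_opair_iff; auto|].
    apply (rel_app Hf), in_prod_pair; auto.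
Qed.

Lemma app2_in f a b c x y : is_fun2 f a b c -> x ∈ a -> y ∈ b -> app2 f x y ∈ c.
Proof.
  intros (p & Hp & Hf) Hx Hy; apply is_prod_iff in Hp as ->.
  apply (app_in Hf), in_prod_pair; auto.
Qed.

Section Real.
Context {R : field_data M} (HR : is_real_field R).

(** Bundling an element with its membership proof makes the field operations total, as [ring]
    requires; by proof irrelevance, equality is still that of the model. *)
Definition real : Type := {x : M | x ∈ reals R}.
Implicit Types i j k l q r : real.

Definition val r : M := proj1_sig r.

Lemma val_in r : val r ∈ reals R.
Proof. exact (proj2_sig r). Qed.

Lemma val_inj q r : val q = val r -> q = r.
Proof.
  destruct q as [x Hx], r as [y Hy]; simpl; intros ->; f_equal; apply proof_irrelevance.
Qed.

Definition zero : real := exist _ (rzero R) (rf_zero HR).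
Definition one : real := exist _ (rone R) (rf_one HR).
Definition plus q r : real :=
  exist _ (app2 (radd R) (val q) (val r)) (app2_in (rf_add HR) (val_in q) (val_in r)).
Definition mult q r : real :=
  exist _ (app2 (rmul R) (val q) (val r)) (app2_in (rf_mul HR) (val_in q) (val_in r)).
Definition le q r : Prop := rel (rle R) (val q) (val r).
Definition lt q r : Prop := rlt R (val q) (val r).

Lemma op_plus q r : op (radd R) (val q) (val r) (val (plus q r)).
Proof. apply (op_iff _ _ _ (rf_add HR)); auto using val_in. Qed.

Lemma op_mult q r : op (rmul R) (val q) (val r) (val (mult q r)).
Proof. apply (op_iff _ _ _ (rf_mul HR)); auto using val_in. Qed.

Lemma op_plus_eq q r l : op (radd R) (val q) (val r) (val l) -> l = plus q r.
Proof. intros H; apply val_inj, (op_iff _ _ _ (rf_add HR)), H. Qed.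

Lemma op_mult_eq q r l : op (rmul R) (val q) (val r) (val l) -> l = mult q r.
Proof. intros H; apply val_inj, (op_iff _ _ _ (rf_mul HR)), H. Qed.

Lemma opp_exists r : exists q, plus r q = zero.
Proof.
  destruct (rf_addN HR (val_in r)) as (y & Hy & H).
  exists (exist _ y Hy); symmetry; apply op_plus_eq, H.
Qed.

(** Chosen outside the model, which is harmless: the inverse is unique, and a formula receives it
    only as a parameter. *)
Definition opp r : real := proj1_sig (constructive_indefinite_description _ (opp_exists r)).
Definition minus q r : real := plus q (opp r).

Lemma real_ring_theory : ring_theory zero one plus mult minus opp eq.
Proof.
  assert (C : forall q r, plus q r = plus r q).
  { intros q r; apply op_plus_eq, (rf_addC HR), op_plus. }
  assert (C' : forall q r, mult q r = mult r q).
  { intros q r; apply op_mult_eq, (rf_mulC HR), op_mult. }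
  split; auto.
  - intros r; rewrite C; symmetry; apply op_plus_eq, (rf_add0 HR), val_in.
  - intros q r l; symmetry; apply val_inj.
    exact (rf_addA HR (op_plus q r) (op_plus _ l) (op_plus r l) (op_plus q _)).
  - intros r; rewrite C'; symmetry; apply op_mult_eq, (rf_mul1 HR), val_in.
  - intros q r l; symmetry; apply val_inj.
    exact (rf_mulA HR (op_mult q r) (op_mult _ l) (op_mult r l) (op_mult q _)).
  - intros q r l; rewrite !(C' _ l); apply val_inj.
    exact (rf_distr HR (op_plus q r) (op_mult l _) (op_mult l q) (op_mult l r)
      (op_plus _ _)).
  - intros r; unfold opp.
    exact (proj2_sig (constructive_indefinite_description _ (opp_exists r))).
Qed.

Add Ring real_ring : real_ring_theory.

Lemma le_refl r : le r r.
Proof. apply (rf_le_refl HR), val_in. Qed.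

Lemma le_antisym q r : le q r -> le r q -> q = r.
Proof. intros H K; apply val_inj, (rf_le_anti HR H K). Qed.

Lemma le_trans q r l : le q r -> le r l -> le q l.
Proof. apply (rf_le_trans HR). Qed.

Lemma le_or_lt q r : le q r \/ lt r q.
Proof.
  destruct (rf_le_total HR (val_in q) (val_in r)) as [H|H]; [auto|].
  destruct (classic (val r = val q)) as [E|E]; [|right; split; auto].
  left; apply val_inj in E as ->; apply le_refl.
Qed.

Lemma lt_le q r : lt q r -> le q r.
Proof. intros [H _]; exact H. Qed.

Lemma lt_not_le q r : lt q r -> ~ le r q.
Proof. intros [H N] K; apply N, (rf_le_anti HR H K). Qed.

Lemma not_le_lt q r : ~ le r q -> lt q r.
Proof. destruct (le_or_lt r q); tauto. Qed.

Lemma le_lt_trans q r l : le q r -> lt r l -> lt q l.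
Proof.
  intros H K; apply not_le_lt; intros L; apply (lt_not_le K), (le_trans L H).
Qed.

Lemma lt_le_trans q r l : lt q r -> le r l -> lt q l.
Proof.
  intros H K; apply not_le_lt; intros L; apply (lt_not_le H), (le_trans K L).
Qed.

Lemma plus_le q r l : le q r -> le (plus q l) (plus r l).
Proof. intros H; exact (rf_le_add HR H (op_plus q l) (op_plus r l)). Qed.

Lemma plus_le_compat i j q r : le i j -> le q r -> le (plus i q) (plus j r).
Proof.
  intros H K; apply (le_trans (plus_le q H)).
  replace (plus j q) with (plus q j) by ring.
  replace (plus j r) with (plus r j) by ring; apply plus_le, K.
Qed.

(** Linear inequalities are checked by comparing differences with [ring]. *)
Lemma le_of_sub q r i j : le i j -> minus j i = minus r q -> le q r.
Proof.
  intros H E; apply (plus_le (plus q (opp i))) in H.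
  replace q with (plus i (plus q (opp i))) by ring.
  replace r with (plus q (minus r q)) by ring; rewrite <- E.
  replace (plus q (minus j i)) with (plus j (plus q (opp i))) by ring; exact H.
Qed.

Lemma lt_of_sub q r i j : lt i j -> minus j i = minus r q -> lt q r.
Proof.
  intros H E; apply not_le_lt; intros K; apply (lt_not_le H), (le_of_sub K).
  replace (minus i j) with (opp (minus j i)) by ring; rewrite E; ring.
Qed.

Lemma plus_lt_compat i j q r : lt i j -> le q r -> lt (plus i q) (plus j r).
Proof.
  intros H K; apply (lt_le_trans (r := plus j q)).
  - apply (lt_of_sub H); ring.
  - apply (le_of_sub K); ring.
Qed.

Lemma mult_nonneg q r : le zero q -> le zero r -> le zero (mult q r).
Proof. intros H K; exact (rf_le_mul HR H K (op_mult q r)). Qed.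

Lemma zero_lt_one : lt zero one.
Proof.
  apply not_le_lt; intros H.
  assert (K : le zero (opp one)) by (apply (le_of_sub H); ring).
  pose proof (mult_nonneg K K) as L.
  replace (mult (opp one) (opp one)) with one in L by ring.
  apply (rf_01 HR), (rf_le_anti HR L H).
Qed.

Lemma half_exists : exists h, plus h h = one.
Proof.
  assert (H2 : lt zero (plus one one)).
  { apply (le_lt_trans (r := plus zero zero)).
    - replace (plus zero zero) with zero by ring; apply le_refl.
    - apply plus_lt_compat; [|apply lt_le]; apply zero_lt_one. }
  assert (N : val (plus one one) <> rzero R) by (intros E; apply H2; symmetry; exact E).
  destruct (rf_mulV HR (val_in (plus one one)) N) as (y & Hy & H).
  exists (exist _ y Hy).
  replace (plus _ _) with (mult (plus one one) (exist _ y Hy)) by ring.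
  symmetry; apply op_mult_eq, H.
Qed.

Definition half : real := proj1_sig (constructive_indefinite_description _ half_exists).

Lemma half_plus_half : plus half half = one.
Proof. exact (proj2_sig (constructive_indefinite_description _ half_exists)). Qed.

Lemma half_split r : plus (mult half r) (mult half r) = r.
Proof.
  replace (plus _ _) with (mult (plus half half) r) by ring.
  rewrite half_plus_half; ring.
Qed.

Lemma half_pos r : lt zero r -> lt zero (mult half r).
Proof.
  intros H; apply not_le_lt; intros K; apply (lt_not_le H).
  rewrite <- (half_split r); apply (le_of_sub (plus_le_compat K K)); ring.
Qed.

Lemma half_lt r : lt zero r -> lt (mult half r) r.
Proof.
  intros H; apply (lt_of_sub (half_pos H)).
  rewrite <- (half_split r) at 2; ring.
Qed.

(** Total on the model, with the arbitrary value [zero] off the reals, so that distances can be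
    written without membership proofs. *)
Definition to_real x : real :=
  match excluded_middle_informative (x ∈ reals R) with
  | left H => exist _ x H
  | right _ => zero
  end.

Lemma val_to_real x : x ∈ reals R -> val (to_real x) = x.
Proof.
  intros H; unfold to_real; destruct (excluded_middle_informative _); tauto.
Qed.

Lemma to_real_val r : to_real (val r) = r.
Proof. apply val_inj, val_to_real, val_in. Qed.

Lemma definable_rlt s t : definable_term s -> definable_term t ->
  definable (fun v => rlt R (s v) (t v)).
Proof. unfold rlt; definability. Qed.
Hint Resolve definable_rlt : definable.

Lemma rlt_in x y : rlt R x y -> x ∈ reals R /\ y ∈ reals R.
Proof. intros [H _]; apply (rf_le HR H). Qed.

Lemma reals_order : linear_order (rlt R) (reals R).
Proof.
  split.
  - intros x _ [_ H]; auto.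
  - intros x y z Hx Hy Hz H K.
    exact (@le_lt_trans (exist _ x Hx) (exist _ y Hy) (exist _ z Hz) (proj1 H) K).
  - intros x y Hx Hy.
    destruct (le_or_lt (exist _ x Hx) (exist _ y Hy)) as [H|H]; [|auto].
    destruct (classic (x = y)); [auto | left; split; auto].
Qed.

(** The witness is the sequence of powers of [half]; a positive lower bound would
    yield a least upper bound [l > 0] of the set of lower bounds, which is closed
    under doubling. *)
Lemma null_sequence : exists e, is_fun e omega (reals R) /\
  (forall n, n ∈ omega -> lt zero (to_real (app e n))) /\
  (forall m n, m ∈ omega -> n ∈ m -> lt (to_real (app e m)) (to_real (app e n))) /\
  (forall r, lt zero r -> exists n, n ∈ omega /\ lt (to_real (app e n)) r).
Proof.
  set (G := fun x => app2 (rmul R) (val half) x).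
  destruct (@recursion (reals R) (rone R) G) as (e & He & He0 & HeS).
  - unfold G; definability.
  - apply (rf_one HR).
  - intros x Hx; apply (app2_in (rf_mul HR)); auto using val_in.
  - set (q := fun n => to_real (app e n)).
    assert (Vq : forall n, n ∈ omega -> val (q n) = app e n).
    { intros n Hn; apply val_to_real, (app_in He Hn). }
    assert (qS : forall n, n ∈ omega -> q (succ n) = mult half (q n)).
    { intros n Hn; apply val_inj; rewrite Vq, HeS by auto using succ_omega.
      unfold G; rewrite <- Vq by exact Hn; reflexivity. }
    assert (P : forall n, n ∈ omega -> lt zero (q n)).
    { intros n Hn.
      (* [real] and [to_real] live outside the model; the induction needs the statement about
         elements of the model. *)
      enough (E : rlt R (rzero R) (app e n)) by (rewrite <- Vq in E; auto).
      omega_induction n Hn.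
      - rewrite He0; exact zero_lt_one.
      - intros n Hn H; rewrite <- Vq in * by auto using succ_omega.
        rewrite qS by exact Hn; apply half_pos, H. }
    exists e; split; [exact He | split; [exact P | split]].
    + enough (K : forall m, m ∈ omega -> forall n, n ∈ m -> rlt R (app e m) (app e n)).
      { intros m n Hm Hn; fold (q m) (q n); unfold lt.
        rewrite !Vq; [auto | apply (omega_elements Hm Hn) | exact Hm]. }
      intros m Hm; omega_induction m Hm.
      * intros n Hn; destruct (in_empty Hn).
      * intros m Hm IH n Hn.
        assert (L : rlt R (app e (succ m)) (app e m)).
        { rewrite <- !Vq, qS by auto using succ_omega; apply half_lt, P, Hm. }
        apply in_succ in Hn as [Hn | ->]; [|exact L].
        apply (lt_trans reals_order (y := app e m));
          auto; apply (app_in He); auto using succ_omega.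
        apply (omega_elements Hm Hn).
    + intros r Hr; apply NNPP; intros N.
      assert (L : forall n, n ∈ omega -> le r (q n)).
      { intros n Hn; destruct (le_or_lt r (q n)) as [H|H]; [exact H|].
        destruct N; eauto. }
      set (A := sep (reals R) (fun b => forall n, n ∈ omega -> rel (rle R) b (app e n))).
      assert (DA : forall b : real, val b ∈ A <-> forall n, n ∈ omega -> le b (q n)).
      { intros b; unfold A; rewrite in_sep by definability; unfold le; split.
        - intros [_ H] n Hn; rewrite Vq; auto.
        - intros H; split; [apply val_in|]; intros n Hn; rewrite <- Vq; auto. }
      destruct (rf_complete HR (A := A)) as (l0 & Hl0 & Hub & Hlub).
      * intros b Hb; apply in_sep in Hb; [apply Hb | definability].
      * exists (val r); apply DA, L.
      * exists (rone R); split; [apply (rf_one HR)|]; intros b Hb.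
        apply in_sep in Hb as [_ Hb]; [|definability].
        rewrite <- He0; apply Hb, empty_omega.
      * set (l := exist _ l0 Hl0 : real).
        assert (Ll : le r l) by (apply Hub, DA, L).
        apply (lt_not_le (half_lt (lt_le_trans Hr Ll))).
        apply (Hlub (val (mult half l)) (val_in _)); intros b0 Hb.
        assert (Hb0 : b0 ∈ reals R)
          by (apply in_sep in Hb; [apply Hb | definability]).
        set (b := exist _ b0 Hb0 : real); change (le b (mult half l)).
        pose proof (proj1 (DA b) Hb) as Kb.
        assert (K : le (plus b b) l).
        { apply Hub, DA; intros n Hn.
          rewrite <- (half_split (q n)), <- qS by exact Hn.
          apply plus_le_compat; apply Kb, succ_omega, Hn. }
        destruct (le_or_lt b (mult half l)) as [H|H]; [exact H|].
        destruct (lt_not_le (plus_lt_compat H (lt_le H))).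
        rewrite half_split; exact K.
Qed.

Lemma common_radius q r : lt zero q -> lt zero r ->
  exists l, lt zero l /\ le l q /\ le l r.
Proof.
  intros Hq Hr; destruct (le_or_lt q r) as [H|H].
  - exists q; auto using le_refl.
  - exists r; auto using le_refl, lt_le.
Qed.

(** * The Hilbert cube *)

Definition trunc r : real := if excluded_middle_informative (le r one) then r else one.

Lemma trunc_le_one r : le (trunc r) one.
Proof.
  unfold trunc; destruct (excluded_middle_informative _); auto using le_refl.
Qed.

Lemma trunc_nonneg r : le zero r -> le zero (trunc r).
Proof.
  unfold trunc; destruct (excluded_middle_informative _); auto.
  intros _; apply lt_le, zero_lt_one.
Qed.

(** The truncated value 1 is below no radius up to 1, so truncated distances still detect all small
    balls. *)
Lemma trunc_lt r l : le l one -> lt (trunc r) l <-> lt r l.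
Proof.
  intros Hl; unfold trunc; destruct (excluded_middle_informative _) as [H|H]; [tauto|].
  apply not_le_lt in H; split; intros K.
  - destruct (lt_not_le K Hl).
  - destruct (lt_not_le (le_lt_trans (lt_le H) K) Hl).
Qed.

Lemma trunc_lipschitz q r l : le zero l -> le r (plus q l) ->
  le (trunc r) (plus (trunc q) l).
Proof.
  intros Hl H; unfold trunc at 2; destruct (excluded_middle_informative _) as [Hq|Hq].
  - unfold trunc; destruct (excluded_middle_informative _) as [Hr|Hr]; [exact H|].
    apply not_le_lt in Hr; apply (le_trans (lt_le Hr) H).
  - apply (le_trans (trunc_le_one r)); apply (le_of_sub Hl); ring.
Qed.

Lemma plus_eq_minus q r l : plus q l = r -> l = minus r q.
Proof. intros <-; ring. Qed.

Lemma abs_unique q r l k : le zero l -> le zero k ->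
  plus q l = r \/ plus r l = q -> plus q k = r \/ plus r k = q -> l = k.
Proof.
  assert (W : forall l k, le zero l -> le zero k ->
    plus q l = r \/ plus r l = q -> plus q k = r \/ plus r k = q -> le l k).
  (* When the signs differ, [l] is the opposite of [k], so the difference of [k] and [l] is
     [plus k k], which is nonnegative. *)
  { clear l k; intros l k Hl Hk [E|E] [E'|E']; apply plus_eq_minus in E, E'; subst;
      try apply le_refl; apply (le_of_sub (plus_le_compat Hk Hk)); ring. }
  intros; apply le_antisym; apply W; assumption.
Qed.

Definition unit_interval : M :=
  sep (reals R) (fun x => rel (rle R) (rzero R) x /\ rel (rle R) x (rone R)).

Lemma in_unit_interval x :
  x ∈ unit_interval <-> rel (rle R) (rzero R) x /\ rel (rle R) x (rone R).
Proof.
  unfold unit_interval; rewrite in_sep by definability; split; [tauto|].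
  intros H; split; [apply (rf_le HR (proj1 H)) | exact H].
Qed.

Lemma val_unit_interval r : val r ∈ unit_interval <-> le zero r /\ le r one.
Proof. apply in_unit_interval. Qed.

Lemma unit_interval_real x : x ∈ unit_interval -> exists r, x = val r.
Proof.
  intros H; apply in_unit_interval in H as [_ H]; apply (rf_le HR) in H as [H _].
  exists (to_real x); symmetry; apply val_to_real, H.
Qed.

Definition usual_metric : M :=
  sep (prod (prod unit_interval unit_interval) (reals R)) (fun p => exists x y z,
    p = opair (opair x y) z /\ rel (rle R) (rzero R) z /\
    (op (radd R) x z y \/ op (radd R) y z x)).

Lemma rel_usual_metric q r z : val q ∈ unit_interval -> val r ∈ unit_interval ->
  rel usual_metric (opair (val q) (val r)) z <->
  exists l, z = val l /\ le zero l /\ (plus q l = r \/ plus r l = q).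
Proof.
  intros Hq Hr; rewrite rel_iff; unfold usual_metric.
  rewrite in_sep by (unfold usual_metric; definability).
  split.
  - intros [Hp (x & y & z' & E & H0 & H)].
    apply in_prod_pair in Hp as [_ Hz].
    apply opair_inj in E as [E <-]; apply opair_inj in E as [<- <-].
    exists (to_real z).
    rewrite <- (val_to_real Hz) in H, H0; rewrite val_to_real by exact Hz.
    split; [reflexivity|]; split; [exact H0|].
    destruct H as [H|H]; apply op_plus_eq in H; auto.
  - intros (l & -> & Hl & H); split.
    + apply in_prod_pair; split; [apply in_prod_pair; auto | apply val_in].
    + exists (val q), (val r), (val l); split; [reflexivity|]; split; [exact Hl|].
      destruct H as [<- | <-]; auto using op_plus.
Qed.

Lemma usual_metric_fun : is_fun2 usual_metric unit_interval unit_interval (reals R).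
Proof.
  exists (prod unit_interval unit_interval); split; [apply is_prod_iff; reflexivity|].
  apply is_fun_intro.
  - intros p Hp; apply in_sep in Hp as [Hp _]; [|definability].
    apply in_prod, Hp.
  - intros p Hp; apply in_prod in Hp as (x & y & Hx & Hy & ->).
    destruct (unit_interval_real Hx) as [q ->], (unit_interval_real Hy) as [r ->].
    destruct (le_or_lt q r) as [H|H]; [exists (val (minus r q)) | exists (val (minus q r))];
      apply rel_usual_metric; auto; eexists; split; [reflexivity | | reflexivity |].
    + split; [apply (le_of_sub H); ring | left; ring].
    + split; [apply (le_of_sub (lt_le H)); ring | right; ring].
  - intros p y z Hy Hz; pose proof Hy as Hp.
    apply rel_iff, in_sep in Hp as [Hp _]; [|definability].
    apply in_prod_pair in Hp as [Hp _]; apply in_prod in Hp as (a & b & Ha & Hb & ->).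
    destruct (unit_interval_real Ha) as [q ->], (unit_interval_real Hb) as [r ->].
    apply rel_usual_metric in Hy as (l & -> & Hl & El); auto.
    apply rel_usual_metric in Hz as (k & -> & Hk & Ek); auto.
    f_equal; apply (abs_unique Hl Hk El Ek).
Qed.

Lemma usual_metric_is_usual : is_usual_metric R unit_interval usual_metric.
Proof.
  split; [exact usual_metric_fun|]; intros x y z H.
  apply (op_iff _ _ _ usual_metric_fun) in H as (Hx & Hy & E).
  destruct (unit_interval_real Hx) as [q ->], (unit_interval_real Hy) as [r ->].
  assert (H : op usual_metric (val q) (val r) z)
    by (apply (op_iff _ _ _ usual_metric_fun); auto).
  destruct H as (p & Hp & H); apply is_opair_iff in Hp as ->.
  apply rel_usual_metric in H as (l & -> & Hl & [<- | <-]); auto using op_plus.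
Qed.

Lemma op_usual_metric q r z : val q ∈ unit_interval -> val r ∈ unit_interval ->
  op usual_metric (val q) (val r) z <->
  exists l, z = val l /\ le zero l /\ (plus q l = r \/ plus r l = q).
Proof.
  intros Hq Hr; rewrite <- rel_usual_metric by assumption; unfold op; split.
  - intros (p & Hp & H); apply is_opair_iff in Hp as ->; exact H.
  - intros H; eexists; split; [apply is_opair_iff; reflexivity | exact H].
Qed.

(** Serves as the one restricted factor of the boxes that show the inverse of the embedding
    continuous. Around [q] the radius [minus r q] works, since points below [q] lie in the interval
    anyway. *)
Lemma initial_interval_open r : metric_open R unit_interval usual_metric
  (sep unit_interval (fun x => rlt R x (val r))).
Proof.
  assert (D : forall x, x ∈ sep unit_interval (fun x => rlt R x (val r)) <->
    x ∈ unit_interval /\ rlt R x (val r)) by (apply in_sep; definability).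
  split; [intros x Hx; apply D in Hx; tauto|].
  intros x Hx; apply D in Hx as [Hx H]; destruct (unit_interval_real Hx) as [q ->].
  change (lt q r) in H.
  exists (val (minus r q)), (sep unit_interval (fun y =>
    exists z, op usual_metric (val q) y z /\ rlt R z (val (minus r q)))).
  split; [change (lt zero (minus r q)); apply (lt_of_sub H); ring|]; split.
  - intros y; apply in_sep; definability.
  - intros y Hy; apply in_sep in Hy as [Hy (z & Hz & L)]; [|definability].
    apply D; split; [exact Hy|]; destruct (unit_interval_real Hy) as [l ->].
    apply op_usual_metric in Hz as (k & -> & Hk & E); auto.
    change (lt k (minus r q)) in L; change (lt l r); destruct E as [<- | <-].
    + apply (lt_of_sub L); ring.
    + apply (le_lt_trans (r := plus l k)); [apply (le_of_sub Hk); ring | exact H].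
Qed.

(** [q] and [r] are to be the values of a 1-Lipschitz map at two points at
    distance [k]. *)
Lemma usual_metric_open_radius U q : metric_open R unit_interval usual_metric U ->
  val q ∈ U -> exists l, lt zero l /\ forall r k, val r ∈ unit_interval ->
    le r (plus q k) -> le q (plus r k) -> lt k l -> val r ∈ U.
Proof.
  intros [Hs H] Hq; destruct (H _ Hq) as (c & B & Hc & HB & HU).
  exists (to_real c); unfold lt; rewrite val_to_real by apply (rlt_in Hc).
  split; [exact Hc|]; intros r k Hr H1 H2 Hk; apply HU, HB; split; [exact Hr|].
  assert (L : forall l, le l k -> rlt R (val l) c).
  { intros l Hl; rewrite <- (val_to_real (x := c)) in * by apply (rlt_in Hc).
    exact (le_lt_trans Hl Hk). }
  pose proof (Hs _ Hq) as HqI.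
  destruct (le_or_lt q r) as [K|K].
  - exists (val (minus r q)); split.
    + apply op_usual_metric; auto; eexists; split; [reflexivity|].
      split; [apply (le_of_sub K); ring | left; ring].
    + apply L, (le_of_sub H1); ring.
  - exists (val (minus q r)); split.
    + apply op_usual_metric; auto; eexists; split; [reflexivity|].
      split; [apply (le_of_sub (lt_le K)); ring | right; ring].
    + apply L, (le_of_sub H2); ring.
Qed.

(** * Metric spaces *)

Section Metric.
Context {X d : M} (Hd : is_metric R X d).

Definition dst x y : real := to_real (app2 d x y).

Lemma val_dst x y : x ∈ X -> y ∈ X -> val (dst x y) = app2 d x y.
Proof. intros Hx Hy; apply val_to_real, (app2_in (proj1 Hd) Hx Hy). Qed.

Lemma op_dst x y z : op d x y z <-> x ∈ X /\ y ∈ X /\ z = val (dst x y).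
Proof.
  rewrite (op_iff _ _ _ (proj1 Hd)); split; intros (Hx & Hy & ->);
    rewrite val_dst by assumption; auto.
Qed.

Lemma dst_op x y : x ∈ X -> y ∈ X -> op d x y (val (dst x y)).
Proof. intros Hx Hy; apply op_dst; auto. Qed.

Lemma dst_nonneg x y : x ∈ X -> y ∈ X -> le zero (dst x y).
Proof. intros Hx Hy; apply (proj1 (proj2 Hd) x y), dst_op; auto. Qed.

Lemma dst_zero x y : x ∈ X -> y ∈ X -> dst x y = zero <-> x = y.
Proof.
  intros Hx Hy; destruct Hd as (_ & _ & H & _).
  rewrite <- (H _ _ _ (dst_op Hx Hy)); split; [intros ->; reflexivity|].
  apply (@val_inj _ zero).
Qed.

Lemma dst_self x : x ∈ X -> dst x x = zero.
Proof. intros Hx; apply (dst_zero Hx Hx); reflexivity. Qed.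

Lemma dst_pos x y : x ∈ X -> y ∈ X -> x <> y -> lt zero (dst x y).
Proof.
  intros Hx Hy N; apply not_le_lt; intros H; apply N, (dst_zero Hx Hy).
  apply (le_antisym H), dst_nonneg; assumption.
Qed.

Lemma dst_sym x y : x ∈ X -> y ∈ X -> dst x y = dst y x.
Proof.
  intros Hx Hy; destruct Hd as (_ & _ & _ & H & _).
  pose proof (H _ _ _ (dst_op Hx Hy)) as K; apply op_dst in K as (_ & _ & K).
  apply val_inj, K.
Qed.

Lemma dst_triangle x y z : x ∈ X -> y ∈ X -> z ∈ X ->
  le (dst x z) (plus (dst x y) (dst y z)).
Proof.
  intros Hx Hy Hz; destruct Hd as (_ & _ & _ & _ & H).
  exact (H _ _ _ _ _ _ _ (dst_op Hx Hy) (dst_op Hy Hz) (dst_op Hx Hz) (op_plus _ _)).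
Qed.

Definition ball x r : M := sep X (fun y => rlt R (app2 d x y) (val r)).

Lemma in_ball x y r : x ∈ X -> y ∈ ball x r <-> y ∈ X /\ lt (dst x y) r.
Proof.
  intros Hx; unfold ball; rewrite in_sep by definability; unfold lt.
  split; intros [Hy H]; rewrite val_dst in * by assumption; auto.
Qed.

Lemma is_ball_iff x r B : x ∈ X -> is_ball R X d x (val r) B <-> B = ball x r.
Proof.
  intros Hx; assert (E : is_ball R X d x (val r) (ball x r)).
  { intros y; rewrite in_ball by exact Hx; split.
    - intros [Hy H]; split; [exact Hy|].
      exists (val (dst x y)); split; [apply dst_op; assumption | exact H].
    - intros (Hy & z & Hz & H); apply op_dst in Hz as (_ & _ & ->); auto. }
  split; [|intros ->; exact E].
  intros H; apply ext; intros y; rewrite (H y), (E y); tauto.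
Qed.

Lemma metric_open_iff U : metric_open R X d U <-> subset U X /\
  forall x, x ∈ U -> exists r, lt zero r /\ subset (ball x r) U.
Proof.
  split; intros [Hs H]; split; auto; intros x Hx.
  - destruct (H x Hx) as (z & B & Hz & HB & HU).
    assert (K : z = val (to_real z)) by (symmetry; apply val_to_real, (rlt_in Hz)).
    rewrite K in Hz, HB; apply is_ball_iff in HB as ->; [|auto]; eauto.
  - destruct (H x Hx) as (r & Hr & HU).
    exists (val r), (ball x r); rewrite is_ball_iff by auto; auto.
Qed.

Lemma center_in_ball x r : x ∈ X -> lt zero r -> x ∈ ball x r.
Proof. intros Hx Hr; apply in_ball; rewrite ?dst_self; auto. Qed.

Lemma ball_open x r : x ∈ X -> metric_open R X d (ball x r).
Proof.
  intros Hx; apply metric_open_iff; split.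
  - intros y Hy; apply in_ball in Hy; tauto.
  - intros y Hy; apply in_ball in Hy as [Hy H]; [|exact Hx].
    exists (minus r (dst x y)); split.
    + apply (lt_of_sub H); ring.
    + intros z Hz; apply in_ball in Hz as [Hz K]; [|exact Hy].
      apply in_ball; [exact Hx|]; split; [exact Hz|].
      apply (le_lt_trans (dst_triangle Hx Hy Hz)), (lt_of_sub K); ring.
Qed.

Lemma isolated_iff x : isolated (metric_open R X d) x <->
  x ∈ X /\ exists r, lt zero r /\ forall y, y ∈ X -> lt (dst x y) r -> y = x.
Proof.
  split.
  - intros (U & HU & E); apply metric_open_iff in HU as [Hs HU].
    assert (Hx : x ∈ U) by (apply E; reflexivity).
    split; [auto|]; destruct (HU x Hx) as (r & Hr & K).
    exists r; split; [exact Hr|]; intros y Hy H; apply E, K, in_ball; auto.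
  - intros (Hx & r & Hr & H); exists (ball x r); split; [apply ball_open, Hx|].
    intros y; split.
    + intros Hy; apply in_ball in Hy as [Hy K]; auto.
    + intros ->; apply center_in_ball; auto.
Qed.

(** * Isolated points *)

Definition Iso : M := sep X (fun x => exists c, rlt R (rzero R) c /\
  forall y, y ∈ X -> rlt R (app2 d x y) c -> y = x).

Lemma Iso_is_Iso : is_Iso (metric_open R X d) Iso.
Proof.
  intros x; rewrite isolated_iff; unfold Iso; rewrite in_sep by definability.
  split; intros [Hx (r & Hr & H)]; split; auto.
  - exists (to_real r); unfold lt; rewrite val_to_real by apply (rlt_in Hr).
    split; [exact Hr|]; intros y Hy; rewrite val_dst by assumption; auto.
  - exists (val r); split; [exact Hr|]; intros y Hy.
    rewrite <- val_dst by assumption; apply H, Hy.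
Qed.

Lemma is_Iso_eq I : is_Iso (metric_open R X d) I -> I = Iso.
Proof. intros H; apply ext; intros x; rewrite (H x), (Iso_is_Iso x); tauto. Qed.

Lemma in_Iso x : x ∈ Iso <->
  x ∈ X /\ exists r, lt zero r /\ forall y, y ∈ X -> lt (dst x y) r -> y = x.
Proof. rewrite (Iso_is_Iso x); apply isolated_iff. Qed.

Lemma Iso_subset : subset Iso X.
Proof. intros x Hx; apply in_Iso in Hx; tauto. Qed.

(** Scatteredness is applied to a nonempty open set itself: a point isolated in an open subspace is
    isolated in the whole space. *)
Lemma scattered_iso_dense :
  scattered X (metric_open R X d) -> iso_dense X (metric_open R X d).
Proof.
  intros H; exists Iso; split; [apply Iso_is_Iso|]; split; [apply Iso_subset|].
  intros U HU HN; pose proof HU as HU'; apply metric_open_iff in HU' as [Hs HU'].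
  destruct (H U Hs HN) as (x & Hx & V & (W & HW & EV) & Ex).
  exists x; split; [exact Hx|]; apply in_Iso; split; [auto|].
  assert (HxW : x ∈ W) by (apply EV, Ex; reflexivity).
  apply metric_open_iff in HW as [_ HW].
  destruct (HU' x Hx) as (q & Hq & Kq), (HW x HxW) as (r & Hr & Kr).
  destruct (common_radius Hq Hr) as (l & Hl & Lq & Lr).
  exists l; split; [exact Hl|]; intros y Hy K; apply Ex, EV; split.
  - apply Kr, in_ball; [auto|]; split; [exact Hy | apply (lt_le_trans K Lr)].
  - apply Kq, in_ball; [auto|]; split; [exact Hy | apply (lt_le_trans K Lq)].
Qed.

Lemma Iso_is_countable : CAC_fin M ->
  limit_point_compact X (metric_open R X d) \/ totally_bounded R X d ->
  countable Iso.
Proof.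
  intros CAC Hcomp; destruct null_sequence as (e & He & Epos & _ & Elim).
  set (eps := fun n => to_real (app e n)).
  assert (Veps : forall n, n ∈ omega -> val (eps n) = app e n).
  { intros n Hn; apply val_to_real, (app_in He Hn). }
  set (A := fun n => sep X (fun x => forall y, y ∈ X ->
    rlt R (app2 d x y) (app e n) -> y = x)).
  assert (HA : definable_term (fun v => A (v 0))) by (unfold A; definability).
  assert (InA : forall n x, n ∈ omega ->
    x ∈ A n <-> x ∈ X /\ forall y, y ∈ X -> lt (dst x y) (eps n) -> y = x).
  { intros n x Hn; unfold A; rewrite in_sep by definability; unfold lt.
    rewrite Veps by exact Hn.
    split; intros [Hx H]; split; auto; intros y Hy; specialize (H y Hy);
      rewrite val_dst in *; auto. }
  apply (countable_union (A := A) CAC HA).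
  - intros n Hn; destruct Hcomp as [H|H].
    + apply NNPP; intros N; destruct (H (A n)) as (x & Hx & Hacc); [|exact N|].
      { intros x Hx; apply InA in Hx; tauto. }
      destruct (Hacc (ball x (eps n))) as (y & Hy & HyA & Nyx).
      * apply ball_open, Hx.
      * apply center_in_ball; [exact Hx | apply Epos, Hn].
      * apply InA in HyA as [_ HyA]; [|exact Hn].
        apply in_ball in Hy as [Hy L]; [|exact Hx].
        apply Nyx; symmetry; apply HyA; [exact Hx|].
        rewrite dst_sym; assumption.
    + destruct (H (val (eps n)) (Epos n Hn)) as (C & HC & HB & Hcov).
      (* A ball of the cover that contains a point [x] of [A n] is the singleton of [x], and its
         [Union] is [x] itself; so the points are recovered without choosing a center for each ball
         in [C]. *)
      apply (finite_subset (a := image C Union)).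
      * apply finite_image; [definability | exact HC].
      * intros x Hx; apply InA in Hx as [Hx K]; [|exact Hn].
        destruct (Hcov x Hx) as (B & HBC & HxB).
        destruct (HB B HBC) as (y & Hy & EB); apply is_ball_iff in EB as ->; [|exact Hy].
        assert (E : forall z, z ∈ ball y (eps n) <-> z = x).
        { apply in_ball in HxB as [_ L]; [|exact Hy].
          rewrite dst_sym in L by assumption; apply K in L as ->; [|exact Hy].
          intros z; rewrite in_ball by exact Hx; split.
          - intros [Hz Lz]; auto.
          - intros ->; rewrite dst_self by exact Hx; split; [exact Hx | apply Epos, Hn]. }
        apply in_image; [definability|]; exists (ball y (eps n)); split; [exact HBC|].
        apply ext; intros z; rewrite in_Union; split.
        -- intros Hz; exists x; split; [apply E; reflexivity | exact Hz].
        -- intros (b & Hb & Hz); apply E in Hb as ->; exact Hz.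
  - intros x Hx; apply in_Iso in Hx as (Hx & r & Hr & K).
    destruct (Elim r Hr) as (n & Hn & L); exists n; split; [exact Hn|].
    apply InA; [exact Hn|]; split; [exact Hx|]; intros y Hy Ly.
    apply K; [exact Hy|]; apply (lt_le_trans Ly), lt_le, L.
Qed.

(** Finite induction takes the place of choosing one radius for each [n]: the smaller of two radii
    is kept at every step. *)
Lemma finite_radius (T : M -> M -> Prop) x E : definable (fun v => T (v 0) (v 1)) ->
  x ∈ X -> finite E ->
  (forall n, n ∈ E -> exists r, lt zero r /\ forall y, y ∈ ball x r -> T n y) ->
  exists r, lt zero r /\ forall n y, n ∈ E -> y ∈ ball x r -> T n y.
Proof.
  intros HT Hx HE.
  (* The same statement with radii as elements of the model, which makes it definable and so open to
     [finite_ind]. *)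
  enough (K : (forall n, n ∈ E -> exists c, rlt R (rzero R) c /\
      forall y, y ∈ X -> rlt R (app2 d x y) c -> T n y) ->
    exists c, rlt R (rzero R) c /\
      forall n y, n ∈ E -> y ∈ X -> rlt R (app2 d x y) c -> T n y).
  { intros H; destruct K as (c & Hc & K).
    - intros n Hn; destruct (H n Hn) as (r & Hr & Kr).
      exists (val r); split; [exact Hr|]; intros y Hy L.
      apply Kr, in_ball; [exact Hx|]; split; [exact Hy|].
      unfold lt; rewrite val_dst by assumption; exact L.
    - exists (to_real c); unfold lt; rewrite val_to_real by apply (rlt_in Hc).
      split; [exact Hc|]; intros n y Hn Hy; apply in_ball in Hy as [Hy L]; [|exact Hx].
      unfold lt in L; rewrite val_to_real, val_dst in L by (auto; apply (rlt_in Hc)).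
      auto. }
  finite_induction E HE.
  - intros _; exists (rone R); split; [exact zero_lt_one|].
    intros n y Hn; destruct (in_empty Hn).
  - intros E m _ IH _ H.
    destruct IH as (c & Hc & K); [intros n Hn; apply H, in_add; auto|].
    destruct (H m) as (c' & Hc' & K'); [apply in_add; auto|].
    destruct (@common_radius (to_real c) (to_real c')) as (r & Hr & L & L');
      [unfold lt; rewrite val_to_real; [assumption | apply (rlt_in Hc)]
      |unfold lt; rewrite val_to_real; [assumption | apply (rlt_in Hc')]|].
    exists (val r); split; [exact Hr|]; intros n y Hn Hy Ly.
    rewrite <- val_dst in Ly by assumption.
    apply in_add in Hn as [Hn | ->].
    + apply K; auto; rewrite <- val_dst by assumption.
      rewrite <- (val_to_real (x := c)) by apply (rlt_in Hc).
      apply (lt_le_trans Ly L).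
    + apply K'; auto; rewrite <- val_dst by assumption.
      rewrite <- (val_to_real (x := c')) by apply (rlt_in Hc').
      apply (lt_le_trans Ly L').
Qed.

(** The coordinates of a point [x] are the distances from [x] to the points of a
    countable dense set, truncated at 1; indices outside the range of the
    enumeration [j] give 0. *)
Lemma separable_embeds : separable X (metric_open R X d) ->
  embeds_in_Hilbert_cube R X (metric_open R X d).
Proof.
  intros (D & HD & HDX & HDd).
  destruct (countable_injection HD) as (j & Hj & Hji).
  (* This is [trunc (dst x c)] written in the language of the model, since [trunc] and [dst] carry
     no certificate. Injectivity of [j] on [D] makes the value unique. *)
  set (coord := fun x n z =>
    (exists c, c ∈ D /\ app j c = n /\
      ((rel (rle R) (app2 d x c) (rone R) /\ z = app2 d x c) \/
       (~ rel (rle R) (app2 d x c) (rone R) /\ z = rone R))) \/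
    (~ (exists c, c ∈ D /\ app j c = n) /\ z = rzero R)).
  set (co := fun x n => the (coord x n)).
  assert (Dco : definable_term (fun v => co (v 0) (v 1)))
    by (unfold co, coord; definability).
  assert (coD : forall x c, x ∈ X -> c ∈ D -> co x (app j c) = val (trunc (dst x c))).
  { intros x c Hx Hc; pose proof (HDX c Hc) as HcX.
    assert (E : val (dst x c) = app2 d x c) by (apply val_dst; assumption).
    apply the_eq.
    - left; exists c; split; [exact Hc|]; split; [reflexivity|]; rewrite <- E.
      unfold trunc; destruct (excluded_middle_informative _) as [H|H]; auto.
    - intros z [(c' & Hc' & Ec & H)|[H _]]; [|destruct H; eauto].
      apply Hji in Ec; auto; subst c'; rewrite <- E in H.
      unfold trunc; destruct (excluded_middle_informative _) as [K|K];
        destruct H as [[H ->]|[H ->]]; auto; destruct (K H) || destruct (H K). }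
  assert (co0 : forall x n, ~ (exists c, c ∈ D /\ app j c = n) -> co x n = val zero).
  { intros x n H; apply the_eq; [right; auto|].
    intros z [(c & Hc & E & _)|[_ ->]]; [destruct H; eauto | reflexivity]. }
  clearbody co.
  assert (coI : forall x n, x ∈ X -> co x n ∈ unit_interval).
  { intros x n Hx; destruct (classic (exists c, c ∈ D /\ app j c = n)) as [H|H].
    - destruct H as (c & Hc & <-); rewrite coD by assumption.
      apply val_unit_interval; split; [|apply trunc_le_one].
      apply trunc_nonneg, dst_nonneg; auto.
    - rewrite co0 by exact H; apply val_unit_interval.
      split; [apply le_refl | apply lt_le, zero_lt_one]. }
  (* All coordinates are 1-Lipschitz, the constant ones included; continuity of the embedding rests
     on this. *)
  assert (coL : forall x y n q r, x ∈ X -> y ∈ X -> co x n = val q -> co y n = val r ->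
    le r (plus q (dst x y))).
  { intros x y n q r Hx Hy Eq Er; pose proof (dst_nonneg Hx Hy) as Hxy.
    destruct (classic (exists c, c ∈ D /\ app j c = n)) as [H|H].
    - destruct H as (c & Hc & <-).
      rewrite coD in Eq, Er by assumption; apply val_inj in Eq as <-, Er as <-.
      pose proof (HDX c Hc) as HcX.
      apply trunc_lipschitz; [exact Hxy|].
      apply (le_of_sub (dst_triangle Hy Hx HcX)); rewrite (dst_sym Hx Hy); ring.
    - rewrite co0 in Eq, Er by assumption; apply val_inj in Eq as <-, Er as <-.
      apply (le_of_sub Hxy); ring. }
  set (Y := sep (power (prod omega unit_interval)) (fun f => is_fun f omega unit_interval)).
  assert (HY : forall f, f ∈ Y <-> is_fun f omega unit_interval).
  { intros f; unfold Y; rewrite in_sep, in_power by definability; split; [tauto|].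
    intros H; split; [|exact H]; intros p Hp.
    apply H in Hp as (x & y & Hx & Hy & E); apply is_opair_iff in E as ->.
    apply in_prod_pair; auto. }
  set (emb := fun x => graph omega (co x)).
  assert (Demb : definable_term (fun v => emb (v 0))) by (unfold emb; definability).
  assert (Dcox : forall x, definable_term (fun v => co x (v 0))) by (intros; definability).
  assert (embY : forall x, x ∈ X -> emb x ∈ Y).
  { intros x Hx; apply HY, graph_is_fun; auto. }
  assert (app_emb : forall x n, n ∈ omega -> app (emb x) n = co x n).
  { intros x n Hn; apply app_graph; auto. }
  assert (rel_emb : forall x n z, rel (emb x) n z <-> n ∈ omega /\ z = co x n).
  { intros x; apply rel_graph, Dcox. }
  clearbody emb.
  (* An open set of the cube that cuts out the image of [U]: the union of the strips on which
     coordinate [app j c] is less than [z], over all balls in [U] about points [c] of [D] with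
     radius [z] at most 1. Taking all such balls avoids a choice among them. *)
  set (V := fun U => sep Y (fun f => exists c z, c ∈ D /\ rel (rle R) z (rone R) /\
    rlt R (rzero R) z /\
    (forall y, y ∈ X -> rlt R (app2 d c y) z -> y ∈ U) /\ rlt R (app f (app j c)) z)).
  assert (InV : forall U f, f ∈ V U <-> f ∈ Y /\ exists c r, c ∈ D /\ le r one /\
    lt zero r /\ subset (ball c r) U /\ rlt R (app f (app j c)) (val r)).
  { intros U f; unfold V; rewrite in_sep by definability.
    apply and_iff_compat_l; split.
    - intros (c & z & Hc & H1 & H0 & HU & L); exists c, (to_real z).
      assert (Hz : z ∈ reals R) by apply (rlt_in H0).
      unfold lt, le; rewrite val_to_real by exact Hz.
      do 3 (split; [assumption|]); split; [|exact L].
      intros y Hy; apply in_ball in Hy as [Hy K]; [|auto].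
      apply HU; [exact Hy|]; unfold lt in K.
      rewrite val_to_real, val_dst in K; auto.
    - intros (c & r & Hc & H1 & H0 & HU & L); exists c, (val r).
      do 3 (split; [assumption|]); split; [|exact L].
      intros y Hy K; apply HU, in_ball; [auto|]; split; [exact Hy|].
      unfold lt; rewrite val_dst; auto. }
  clearbody V.
  assert (key : forall U x, metric_open R X d U -> x ∈ X -> emb x ∈ V U <-> x ∈ U).
  { intros U x HU Hx; rewrite InV; split.
    - intros (_ & c & r & Hc & H1 & H0 & HB & L).
      apply HB, in_ball; [auto|]; split; [exact Hx|].
      rewrite app_emb, coD in L by (auto; apply (app_in Hj Hc)).
      rewrite dst_sym by auto; apply (trunc_lt _ H1), L.
    - intros HxU; split; [apply embY, Hx|].
      apply metric_open_iff in HU as [_ HU]; destruct (HU x HxU) as (r & Hr & HB).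
      (* At most half of [r], so that the ball of radius [l] about a point [c] within [l] of [x]
         stays in the ball of radius [r] about [x]; at most 1, so that truncation is harmless. *)
      destruct (common_radius (half_pos Hr) zero_lt_one) as (l & Hl & Lr & L1).
      destruct (HDd (ball x l)) as (c & Hc & HcD).
      + apply ball_open, Hx.
      + exists x; apply center_in_ball; assumption.
      + apply in_ball in Hc as [Hc L]; [|exact Hx].
        exists c, l; do 3 (split; [assumption|]); split.
        * intros y Hy; apply in_ball in Hy as [Hy K]; [|exact Hc].
          apply HB, in_ball; [exact Hx|]; split; [exact Hy|].
          apply (le_lt_trans (dst_triangle Hx Hc Hy)).
          rewrite <- (half_split r).
          apply (lt_le_trans (plus_lt_compat L (lt_le K)) (plus_le_compat Lr Lr)).
        * rewrite app_emb, coD by (auto; apply (app_in Hj HcD)).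
          apply (trunc_lt _ L1), L. }
  (* Injectivity also comes from [key]: the ball about [x] of radius [dst x y] contains [x] but not
     [y]. *)
  assert (emb_inj : forall x y, x ∈ X -> y ∈ X -> emb x = emb y -> x = y).
  { intros x y Hx Hy E; apply NNPP; intros N.
    assert (H : y ∈ ball x (dst x y)).
    { apply key; [apply ball_open, Hx | exact Hy |]; rewrite <- E.
      apply key; [apply ball_open, Hx | exact Hx |].
      apply center_in_ball, dst_pos; assumption. }
    apply in_ball in H as [_ H]; [|exact Hx].
    apply (lt_not_le H), le_refl. }
  exists omega, unit_interval, usual_metric, Y.
  split; [apply omega_is_omega|]; split; [exact in_unit_interval|].
  split; [exact usual_metric_is_usual|]; split; [exact HY|].
  exists (image X emb).
  assert (InA : forall f, f ∈ image X emb <-> exists x, x ∈ X /\ f = emb x)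
    by (apply in_image; exact Demb).
  split; [intros f Hf; apply InA in Hf as (x & Hx & ->); auto|].
  set (inv := fun f => the (fun x => x ∈ X /\ f = emb x)).
  assert (Dinv : definable_term (fun v => inv (v 0))) by (unfold inv; definability).
  assert (inv_emb : forall x, x ∈ X -> inv (emb x) = x).
  { intros x Hx; apply the_eq; [auto|]; intros y [Hy E]; apply emb_inj; auto. }
  exists (graph X emb), (graph (image X emb) inv); split; [|split; [|split; [|split]]].
  - apply graph_is_fun; [exact Demb|]; intros x Hx; apply InA; eauto.
  - apply graph_is_fun; [exact Dinv|]; intros f Hf; apply InA in Hf as (x & Hx & ->).
    rewrite inv_emb; assumption.
  - intros x f; rewrite !rel_graph by assumption; split.
    + intros [Hx ->]; rewrite inv_emb by exact Hx; split; [apply InA; eauto | reflexivity].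
    + intros [Hf ->]; apply InA in Hf as (x & Hx & ->); rewrite inv_emb by exact Hx; auto.
  - intros V' (W & [_ HW] & EV').
    exists (sep X (fun x => emb x ∈ V')).
    assert (DU : forall x, x ∈ sep X (fun x => emb x ∈ V') <-> x ∈ X /\ emb x ∈ V')
      by (apply in_sep; definability).
    split.
    + apply metric_open_iff; split; [intros x Hx; apply DU in Hx; tauto|].
      intros x Hx; apply DU in Hx as [Hx HxV]; apply EV' in HxV as [HxW _].
      destruct (HW _ HxW) as (F & u & c & HF & HFf & Hu & Huo & Hbox & Hsub).
      (* A box restricts only the coordinates in the finite set [F], and by [coL] each of them
         tolerates some radius about [x]. *)
      destruct (@finite_radius (fun n y => forall U, rel u n U -> co y n ∈ U) x F)
        as (r & Hr & K).
      * definability.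
      * exact Hx.
      * exact HFf.
      * intros n Hn; pose proof (HF n Hn) as Hno.
        pose proof (rel_app Hu Hn) as Hun.
        destruct (unit_interval_real (coI x n Hx)) as [q Eq].
        assert (HqU : val q ∈ app u n).
        { apply (Hbox n _ _ Hun); rewrite <- Eq; apply rel_emb; auto. }
        destruct (usual_metric_open_radius (Huo _ _ Hun) HqU) as (l & Hl & KU).
        exists l; split; [exact Hl|]; intros y Hy U HU.
        apply in_ball in Hy as [Hy L]; [|exact Hx].
        rewrite <- (app_eq Hu HU).
        destruct (unit_interval_real (coI y n Hy)) as [k Ek]; rewrite Ek.
        apply (KU k (dst x y)).
        -- rewrite <- Ek; apply coI, Hy.
        -- apply (coL x y n); assumption.
        -- rewrite dst_sym by assumption; apply (coL y x n); assumption.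
        -- exact L.
      * exists r; split; [exact Hr|]; intros y Hy.
        assert (Ky : forall n, n ∈ F -> forall U, rel u n U -> co y n ∈ U) by auto.
        apply in_ball in Hy as [Hy _]; [|exact Hx].
        apply DU; split; [exact Hy|]; apply EV'; split; [|apply InA; eauto].
        apply Hsub; [apply embY, Hy|]; intros n U z HU Hz.
        apply rel_emb in Hz as [Hn ->].
        apply Ky; [apply (fun_dom Hu HU) | exact HU].
    + intros x; rewrite DU; split; intros [Hx H]; (split; [exact Hx|]).
      * exists (emb x); split; [apply rel_graph; auto | exact H].
      * destruct H as (f & Hf & HfV); apply rel_graph in Hf as [_ ->]; auto.
  - intros U HU; exists (sep (V U) (fun f => f ∈ image X emb)).
    assert (DV : forall f, f ∈ sep (V U) (fun f => f ∈ image X emb) <->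
      f ∈ V U /\ f ∈ image X emb) by (apply in_sep; definability).
    split.
    + exists (V U); split; [|exact DV].
      split; [intros f Hf; apply InV in Hf; tauto|].
      intros f Hf; apply InV in Hf as (HfY & c & r & Hc & H1 & H0 & HB & L).
      set (W := sep unit_interval (fun x => rlt R x (val r))).
      assert (DW : forall x, x ∈ W <-> x ∈ unit_interval /\ rlt R x (val r))
        by (apply in_sep; definability).
      (* Membership of [f] in [V U] is witnessed by one coordinate, so the box restricts only the
         index [app j c], to values below [r]; the same [c] and [r] are witnesses for every point of
         the box. *)
      set (F := add (app j c) empty).
      assert (DF : forall n, n ∈ F <-> n = app j c).
      { intros n; unfold F; rewrite in_add; split; [|auto].
        intros [H|H]; [destruct (in_empty H) | exact H]. }
      assert (Hjc : app j c ∈ omega) by apply (app_in Hj Hc).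
      assert (Dc : definable_term (fun _ : nat -> M => W)) by definability.
      exists F, (graph F (fun _ => W)), (add W empty).
      split; [intros n Hn; apply DF in Hn as ->; exact Hjc|].
      split; [apply finite_add, finite_empty|].
      split; [apply graph_is_fun; [exact Dc|]; intros; apply in_add; auto|].
      split; [intros n U' H; apply rel_graph in H as [_ ->];
        [apply initial_interval_open | exact Dc]|].
      apply HY in HfY; split.
      * intros n U' x H Hx; apply rel_graph in H as [Hn ->]; [|exact Dc].
        apply DF in Hn as ->; apply (rel_app_iff _ _ HfY) in Hx as [_ ->].
        apply DW; split; [apply (app_in HfY Hjc) | exact L].
      * intros g Hg Hbox; apply InV; split; [exact Hg|].
        exists c, r; do 4 (split; [assumption|]).
        apply HY in Hg; apply DW, (Hbox (app j c) W); [|apply (rel_app Hg Hjc)].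
        apply rel_graph; [exact Dc|]; rewrite DF; auto.
    + intros f; rewrite DV; split.
      * intros [HfV HfA]; split; [exact HfA|].
        apply InA in HfA as (x & Hx & ->); exists x; split.
        -- apply rel_graph; [exact Dinv|]; rewrite inv_emb by exact Hx.
           split; [apply InA; eauto | reflexivity].
        -- apply (key U x HU Hx), HfV.
      * intros [HfA (x & Hx & HxU)]; split; [|exact HfA].
        apply rel_graph in Hx as [_ ->]; [|exact Dinv].
        apply InA in HfA as (x & Hx & ->); rewrite inv_emb in HxU by exact Hx.
        apply (key U x HU Hx), HxU.
Qed.

End Metric.

Arguments dst : clear implicits.
Arguments ball : clear implicits.
Arguments Iso : clear implicits.

(** * From metric spaces to choice *)

(** The one order of [Z] restricts to every member [a] through [opair a]. Least elements are unique,
    hence given by a definable term, whose graph is the choice function. *)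
Lemma choice_from_order lt Z (F : M) : definable (fun v => lt (v 0) (v 1)) ->
  linear_order lt Z -> (forall a x, a ∈ F -> x ∈ a -> opair a x ∈ Z) ->
  (forall a, a ∈ F -> nonempty a /\ finite a) ->
  exists u f : M, is_fun f F u /\ forall a x, rel f a x -> x ∈ a.
Proof.
  intros Hlt HZ HF Hfin.
  set (least := fun a => the (is_least (fun x y => lt (opair a x) (opair a y)) a)).
  assert (D : definable_term (fun v => least (v 0)))
    by (unfold least, is_least; definability).
  assert (H : forall a, a ∈ F -> least a ∈ a).
  { intros a Ha; destruct (Hfin a Ha) as [Hne Hf].
    assert (HL : linear_order (fun x y => lt (opair a x) (opair a y)) a).
    { apply (linear_order_preimage (K := opair a) HZ); [auto|].
      intros x y _ _ E; apply opair_inj in E; tauto. }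
    enough (L : is_least (fun x y => lt (opair a x) (opair a y)) a (least a)) by apply L.
    apply (the_spec (is_least _ a)).
    destruct (finite_least (lt := fun x y => lt (opair a x) (opair a y)) (A := a) (a := a))
      as [m Hm]; try assumption.
    - definability.
    - intros x Hx; exact Hx.
    - exists m; split; [exact Hm|]; intros z Hz.
      apply (is_least_unique HL (fun x Hx => Hx) Hm Hz). }
  exists (Union F), (graph F least); split.
  - apply graph_is_fun; [exact D|]; intros a Ha; apply in_Union; eauto.
  - intros a x Hx; apply rel_graph in Hx as [Ha ->]; auto.
Qed.

(** Distinct points are joined through a common center at distance [w] from each. *)
Section Hedgehog.
Context (X : M) (w : M -> M) (Dw : definable_term (fun v => w (v 0))).
Context (w_in : forall x, x ∈ X -> w x ∈ reals R).
Context (w_nonneg : forall x, x ∈ X -> le zero (to_real (w x))).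
(** Allows at most one point of weight 0, which is then the common center itself. *)
Context (w_pos : forall x y, x ∈ X -> y ∈ X -> x <> y ->
  lt zero (plus (to_real (w x)) (to_real (w y)))).

Definition hedgehog : M := graph (prod X X) (fun p => the (fun z => exists x y,
  p = opair x y /\ ((x = y /\ z = rzero R) \/ (x <> y /\ z = app2 (radd R) (w x) (w y))))).

Definition hedgehog_dst x y : real :=
  if excluded_middle_informative (x = y) then zero
  else plus (to_real (w x)) (to_real (w y)).

Lemma op_hedgehog x y z :
  op hedgehog x y z <-> x ∈ X /\ y ∈ X /\ z = val (hedgehog_dst x y).
Proof.
  assert (E : forall x y, x ∈ X -> y ∈ X -> the (fun z => exists x' y',
    opair x y = opair x' y' /\ ((x' = y' /\ z = rzero R) \/
      (x' <> y' /\ z = app2 (radd R) (w x') (w y')))) = val (hedgehog_dst x y)).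
  { intros a b Ha Hb.
    assert (V : val (plus (to_real (w a)) (to_real (w b))) = app2 (radd R) (w a) (w b)).
    { unfold plus; simpl; rewrite !val_to_real by auto; reflexivity. }
    apply the_eq.
    - exists a, b; split; [reflexivity|]; unfold hedgehog_dst.
      destruct (excluded_middle_informative _); auto.
    - intros c (a' & b' & E & H); apply opair_inj in E as [<- <-]; unfold hedgehog_dst.
      destruct (excluded_middle_informative _) as [K|K], H as [[H ->]|[H ->]];
        try contradiction; auto. }
  unfold op, hedgehog; split.
  - intros (p & Hp & H); apply is_opair_iff in Hp as ->.
    apply rel_graph in H as [H ->]; [|definability].
    apply in_prod_pair in H as [Hx Hy]; rewrite E; auto.
  - intros (Hx & Hy & ->); exists (opair x y); split; [apply is_opair_iff; reflexivity|].
    apply rel_graph; [definability|]; rewrite E, in_prod_pair; auto.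
Qed.

Lemma hedgehog_self x : hedgehog_dst x x = zero.
Proof. unfold hedgehog_dst; destruct (excluded_middle_informative _); tauto. Qed.

Lemma hedgehog_neq x y : x <> y ->
  hedgehog_dst x y = plus (to_real (w x)) (to_real (w y)).
Proof. unfold hedgehog_dst; destruct (excluded_middle_informative _); tauto. Qed.

Lemma hedgehog_nonneg x y : x ∈ X -> y ∈ X -> le zero (hedgehog_dst x y).
Proof.
  intros Hx Hy; destruct (classic (x = y)) as [<- | N].
  - rewrite hedgehog_self; apply le_refl.
  - rewrite hedgehog_neq by exact N; apply lt_le, w_pos; assumption.
Qed.

Lemma hedgehog_is_metric : is_metric R X hedgehog.
Proof.
  split; [|split; [|split; [|split]]].
  - exists (prod X X); split; [apply is_prod_iff; reflexivity|].
    apply graph_is_fun; [definability|].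
    intros p Hp; apply in_prod in Hp as (x & y & Hx & Hy & ->).
    assert (H : op hedgehog x y (val (hedgehog_dst x y))) by (apply op_hedgehog; auto).
    destruct H as (p & Hp & H); apply is_opair_iff in Hp as ->.
    apply rel_graph in H as [_ <-]; [apply val_in | definability].
  - intros x y z H; apply op_hedgehog in H as (Hx & Hy & ->).
    apply hedgehog_nonneg; assumption.
  - intros x y z H; apply op_hedgehog in H as (Hx & Hy & ->); split.
    + intros E; apply (@val_inj _ zero) in E; apply NNPP; intros N.
      apply (lt_not_le (w_pos Hx Hy N)); rewrite <- hedgehog_neq, E by exact N.
      apply le_refl.
    + intros <-; rewrite hedgehog_self; reflexivity.
  - intros x y z H; apply op_hedgehog in H as (Hx & Hy & ->); apply op_hedgehog.
    split; [exact Hy|]; split; [exact Hx|]; f_equal.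
    destruct (classic (x = y)) as [<- | N]; [reflexivity|].
    rewrite !hedgehog_neq by auto; ring.
  - intros x y z a b c s H1 H2 H3 H4.
    apply op_hedgehog in H1 as (Hx & Hy & ->), H2 as (_ & Hz & ->), H3 as (_ & _ & ->).
    apply (op_iff _ _ _ (rf_add HR)) in H4 as (_ & _ & ->).
    change (le (hedgehog_dst x z) (plus (hedgehog_dst x y) (hedgehog_dst y z))).
    destruct (classic (x = z)) as [<- | N].
    + rewrite hedgehog_self.
      apply (le_of_sub (plus_le_compat (hedgehog_nonneg Hx Hy) (hedgehog_nonneg Hy Hx))).
      ring.
    + destruct (classic (x = y)) as [<- | Nxy].
      { rewrite hedgehog_self; apply (le_of_sub (le_refl zero)); ring. }
      destruct (classic (y = z)) as [<- | Nyz].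
      { rewrite hedgehog_self; apply (le_of_sub (le_refl zero)); ring. }
      rewrite !hedgehog_neq by assumption.
      apply (le_of_sub (plus_le_compat (w_nonneg Hy) (w_nonneg Hy))); ring.
Qed.

Lemma dst_hedgehog x y : x ∈ X -> y ∈ X -> dst hedgehog x y = hedgehog_dst x y.
Proof.
  intros Hx Hy; pose proof (dst_op hedgehog_is_metric Hx Hy) as H.
  apply op_hedgehog in H as (_ & _ & H); apply val_inj, H.
Qed.

(** Every other point [y] is at distance [w x] plus [w y], which is no less than [w x]; so this
    radius isolates [x]. *)
Lemma hedgehog_ball x : x ∈ X -> lt zero (to_real (w x)) ->
  forall y, y ∈ ball X hedgehog x (to_real (w x)) <-> y = x.
Proof.
  intros Hx Hpos y; rewrite (in_ball hedgehog_is_metric) by exact Hx; split.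
  - intros [Hy L]; rewrite dst_hedgehog in L by assumption.
    apply NNPP; intros N; rewrite hedgehog_neq in L by auto.
    apply (lt_not_le L), (le_of_sub (w_nonneg Hy)); ring.
  - intros ->; rewrite dst_hedgehog, hedgehog_self by exact Hx; auto.
Qed.

End Hedgehog.

Lemma opair_nonempty x y : opair x y <> empty.
Proof.
  intros E; apply (@in_empty (upair x x)); rewrite <- E; apply in_upair; auto.
Qed.

Lemma totally_bounded_intro X d : is_metric R X d ->
  (forall r, lt zero r -> exists S, finite S /\ subset S X /\
    forall y, y ∈ X -> exists x, x ∈ S /\ lt (dst d x y) r) -> totally_bounded R X d.
Proof.
  intros Hd H c Hc; assert (Ec : val (to_real c) = c) by apply val_to_real, (rlt_in Hc).
  destruct (H (to_real c)) as (S & HS & HSX & Hcov).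
  { unfold lt; rewrite Ec; exact Hc. }
  assert (Db : forall b, b ∈ image S (fun x => ball X d x (to_real c)) <->
    exists x, x ∈ S /\ b = ball X d x (to_real c)).
  { apply in_image; unfold ball; definability. }
  exists (image S (fun x => ball X d x (to_real c))); split; [|split].
  - apply finite_image; [unfold ball; definability | exact HS].
  - intros b Hb; apply Db in Hb as (x & Hx & ->); exists x; split; [auto|].
    rewrite <- Ec at 1; apply (is_ball_iff Hd); auto.
  - intros y Hy; destruct (Hcov y Hy) as (x & Hx & L).
    exists (ball X d x (to_real c)); split; [apply Db; eauto|].
    apply (in_ball Hd); auto.
Qed.

(** The space is the disjoint union of the members of [F] with one more point,
    [empty]: the points of the [n]-th member are at distance [e n] from it. *)
Lemma disjoint_union_space (F : M) : denumerable F -> (forall a, a ∈ F -> finite a) ->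
  exists X d Z, is_metric R X d /\ scattered X (metric_open R X d) /\
    totally_bounded R X d /\ subset Z (Iso X d) /\
    forall a x, a ∈ F -> x ∈ a -> opair a x ∈ Z.
Proof.
  intros HF Hfin.
  destruct HF as (w0 & Hw & HF); apply is_omega_eq in Hw as ->.
  apply equipotent_iff in HF as (b & Hb & Hinj & _).
  destruct null_sequence as (e & He & Epos & Edec & Elim).
  set (Z := sep (prod F (Union F)) (fun p => exists a x, x ∈ a /\ p = opair a x)).
  assert (DZ : forall p, p ∈ Z <-> exists a x, a ∈ F /\ x ∈ a /\ p = opair a x).
  { intros p; unfold Z; rewrite in_sep, in_prod by definability; split.
    - intros [(a & x & Ha & _ & ->) (a' & x' & Hx & E)]; apply opair_inj in E as [<- <-].
      eauto.
    - intros (a & x & Ha & Hx & ->); split; [|eauto].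
      exists a, x; rewrite in_Union; eauto. }
  clearbody Z.
  (* [empty] is not an ordered pair, so it is a new point; it gets weight 0 and is the center of the
     hedgehog. *)
  set (X := add empty Z).
  assert (DX : forall p, p ∈ X <-> p ∈ Z \/ p = empty) by (intros; apply in_add).
  set (w := fun p => the (fun z =>
    (exists a x, p = opair a x /\ z = app e (app b a)) \/ (p = empty /\ z = rzero R))).
  assert (Dw : definable_term (fun v => w (v 0))) by (unfold w; definability).
  assert (wZ : forall a x, w (opair a x) = app e (app b a)).
  { intros a x; apply the_eq; [left; eauto|].
    intros z [(a' & x' & E & ->)|[E _]]; [|destruct (opair_nonempty E)].
    apply opair_inj in E as [<- _]; reflexivity. }
  assert (w_empty : w empty = rzero R).
  { apply the_eq; [right; auto|]; intros z [(a & x & E & _)|[_ ->]]; [|reflexivity].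
    destruct (opair_nonempty (eq_sym E)). }
  clearbody w.
  assert (w_in : forall p, p ∈ X -> w p ∈ reals R).
  { intros p Hp; apply DX in Hp as [Hp | ->]; [|rewrite w_empty; apply (rf_zero HR)].
    apply DZ in Hp as (a & x & Ha & _ & ->); rewrite wZ.
    apply (app_in He), (app_in Hb Ha). }
  assert (wpos : forall p, p ∈ Z -> lt zero (to_real (w p))).
  { intros p Hp; apply DZ in Hp as (a & x & Ha & _ & ->); rewrite wZ.
    apply Epos, (app_in Hb Ha). }
  assert (wr0 : to_real (w empty) = zero) by (rewrite w_empty; exact (to_real_val zero)).
  assert (w_nonneg : forall p, p ∈ X -> le zero (to_real (w p))).
  { intros p Hp; apply DX in Hp as [Hp | ->]; [apply lt_le, wpos, Hp|].
    rewrite wr0; apply le_refl. }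
  assert (w_pos : forall p (q : M), p ∈ X -> q ∈ X -> p <> q ->
    lt zero (plus (to_real (w p)) (to_real (w q)))).
  { intros p q Hp Hq N.
    assert (K : forall p (q : M), p ∈ Z -> q ∈ X ->
      lt zero (plus (to_real (w p)) (to_real (w q)))).
    { clear p q Hp Hq N; intros p q Hp Hq.
      apply (le_lt_trans (r := plus zero zero)).
      - apply (le_of_sub (le_refl zero)); ring.
      - apply plus_lt_compat; auto. }
    pose proof Hp as Hp'; apply DX in Hp' as [Hp' | ->]; [auto|].
    pose proof Hq as Hq'; apply DX in Hq' as [Hq' | ->]; [|tauto].
    replace (plus _ _) with (plus (to_real (w q)) (to_real (w empty))) by ring; auto. }
  set (d := hedgehog X w).
  assert (Hd : is_metric R X d) by (apply hedgehog_is_metric; assumption).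
  assert (ballZ : forall p, p ∈ Z -> forall y, y ∈ ball X d p (to_real (w p)) <-> y = p).
  { intros p Hp; apply hedgehog_ball; auto; apply DX; auto. }
  assert (HX0 : empty ∈ X) by (apply DX; auto).
  assert (HZX : forall p, p ∈ Z -> p ∈ X) by (intros; apply DX; auto).
  assert (d0 : forall p, p ∈ X -> dst d empty p = to_real (w p)).
  { intros p Hp; unfold d; rewrite dst_hedgehog by assumption.
    destruct (classic (empty = p)) as [<- | N].
    - rewrite hedgehog_self; auto.
    - rewrite hedgehog_neq, wr0 by exact N; ring. }
  clearbody d.
  exists X, d, Z; split; [exact Hd|]; split; [|split; [|split]].
  (* Points of [Z] are isolated in the whole space, and a nonempty subspace without any of them is
     the singleton of [empty]. *)
  - intros A HA [x Hx].
    destruct (classic (exists p, p ∈ A /\ p ∈ Z)) as [(p & HpA & HpZ)|N].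
    + exists p; split; [exact HpA|].
      exists (add p empty); split.
      * exists (ball X d p (to_real (w p))); split; [apply (ball_open Hd); auto|].
        intros y; rewrite ballZ, in_add by exact HpZ; split.
        -- intros [Hy | ->]; [destruct (in_empty Hy) | auto].
        -- intros [-> _]; auto.
      * intros y; rewrite in_add; split; [|auto].
        intros [Hy | ->]; [destruct (in_empty Hy) | reflexivity].
    + assert (E : forall y, y ∈ A -> y = empty).
      { intros y Hy; destruct (proj1 (DX y) (HA y Hy)); [destruct N; eauto | assumption]. }
      exists x; split; [exact Hx|]; exists A; split.
      * exists X; split; [|intros y; split; [auto | tauto]].
        apply (metric_open_iff Hd); split; [intros y Hy; exact Hy|].
        intros y Hy; exists one; split; [apply zero_lt_one|].
        intros z Hz; apply (in_ball Hd) in Hz; tauto.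
      * intros y; split; [intros Hy; rewrite (E y Hy), (E x Hx); reflexivity|].
        intros ->; exact Hx.
  - apply (totally_bounded_intro Hd); intros r Hr.
    destruct (Elim r Hr) as (n & Hn & Ln).
    set (T := fun k : M => sep Z (fun p => exists a x, p = opair a x /\ app b a = k)).
    assert (DT : definable_term (fun v => T (v 0))) by (unfold T; definability).
    assert (InT : forall (k : M) p, p ∈ T k <->
      p ∈ Z /\ exists a x, p = opair a x /\ app b a = k).
    { intros k; apply in_sep; definability. }
    clearbody T.
    assert (FT : forall k : M, finite (T k)).
    { intros k; destruct (empty_or_inhabited (T k)) as [-> | [p Hp]];
        [apply finite_empty|].
      apply InT in Hp as [Hp (a & x & -> & Ek)].
      apply DZ in Hp as (a' & x' & Ha & _ & E); apply opair_inj in E as [<- _].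
      apply (finite_subset (a := image a (opair a))).
      - apply finite_image; [definability | auto].
      - intros q Hq; apply InT in Hq as [Hq (c & y & -> & Ek')].
        apply DZ in Hq as (c' & y' & Hc & Hy & E); apply opair_inj in E as [<- <-].
        assert (c = a) as -> by (apply Hinj; congruence).
        apply in_image; [definability | eauto]. }
    (* The center is within [r] of every point of weight below [r]. The other points have index at
       most [n], because the weights decrease; there are finitely many of them, and each covers
       itself. *)
    exists (add empty (Union (image (succ n) T))); split; [|split].
    + apply finite_add, finite_Union.
      * apply finite_image; [exact DT | apply finite_omega_element, succ_omega, Hn].
      * intros c Hc; apply in_image in Hc as (k & _ & ->); [apply FT | exact DT].
    + intros p Hp; apply in_add in Hp as [Hp | ->]; [|exact HX0].
      apply in_Union in Hp as (c & Hc & Hp).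
      apply in_image in Hc as (k & _ & ->); [|exact DT].
      apply InT in Hp; apply HZX, Hp.
    + intros p Hp; destruct (le_or_lt r (to_real (w p))) as [L|L].
      * exists p; rewrite (dst_self Hd) by exact Hp; split; [|exact Hr].
        apply in_add; pose proof Hp as Hp'; apply DX in Hp' as [Hp' | ->]; [left | auto].
        pose proof Hp' as HpZ; apply DZ in Hp' as (a & x & Ha & Hx & ->).
        rewrite wZ in L; pose proof (app_in Hb Ha) as Hba.
        apply in_Union; exists (T (app b a)); split; [|apply InT; eauto].
        apply in_image; [exact DT|]; exists (app b a); split; [|reflexivity].
        apply in_succ; destruct (omega_total Hba Hn) as [H|[H|H]]; auto.
        destruct (lt_not_le (le_lt_trans L (Edec _ _ Hba H)) (lt_le Ln)).
      * exists empty; rewrite d0 by exact Hp; split; [apply in_add; auto | exact L].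
  - intros p Hp; apply (in_Iso Hd); split; [auto|].
    exists (to_real (w p)); split; [auto|]; intros y Hy L.
    apply (ballZ p Hp), (in_ball Hd); auto.
  - intros a x Ha Hx; apply DZ; eauto.
Qed.

(** * Linear orders on the isolated points *)

Lemma lexicographic_order I Y : subset I (reals R) ->
  (forall f, f ∈ Y -> is_fun f omega I) ->
  linear_order (fun f g => exists n, n ∈ omega /\ rlt R (app f n) (app g n) /\
    forall m, m ∈ n -> app f m = app g m) Y.
Proof.
  intros HI HY.
  assert (V : forall f n, f ∈ Y -> n ∈ omega -> app f n ∈ reals R).
  { intros f n Hf Hn; apply HI, (app_in (HY f Hf) Hn). }
  split.
  - intros f Hf (n & Hn & L & _); apply (lt_irrefl reals_order (V f n Hf Hn) L).
  - intros f g h Hf Hg Hh (n & Hn & L & E) (m & Hm & L' & E').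
    destruct (omega_total Hn Hm) as [H|[<- | H]].
    + exists n; split; [exact Hn|]; split; [rewrite <- E' by exact H; exact L|].
      intros k Hk; rewrite E by exact Hk; apply E', (omega_trans Hm Hk H).
    + exists n; split; [exact Hn|]; split.
      * apply (lt_trans reals_order (y := app g n)); auto.
      * intros k Hk; rewrite E, E'; auto.
    + exists m; split; [exact Hm|]; split; [rewrite E by exact H; exact L'|].
      intros k Hk; rewrite <- E' by exact Hk; apply E, (omega_trans Hn Hk H).
  - intros f g Hf Hg.
    destruct (classic (exists n, n ∈ omega /\ app f n <> app g n)) as [H|N].
    (* Totality rests on the first index at which the two functions differ. *)
    + apply omega_least in H as (n & Hn & H & K); [|definability].
      assert (E : forall m, m ∈ n -> app f m = app g m)
        by (intros m Hm; apply NNPP, K, Hm).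
      destruct (lt_total reals_order (app f n) (app g n)) as [L|[L|L]]; auto.
      * left; exists n; auto.
      * contradiction.
      * right; right; exists n; split; [exact Hn|]; split; [exact L|].
        intros m Hm; symmetry; auto.
    + right; left; apply (fun_ext (HY f Hf) (HY g Hg)); intros n Hn.
      apply NNPP; intros K; apply N; eauto.
Qed.

Lemma order_of_injection f a b lt : definable (fun v => lt (v 0) (v 1)) ->
  linear_order lt b -> is_fun f a b -> injective f ->
  exists lt', definable (fun v => lt' (v 0) (v 1)) /\ linear_order lt' a.
Proof.
  intros Hlt HL Hf Hi; exists (fun x y => lt (app f x) (app f y)); split.
  - definability.
  - apply (linear_order_preimage (K := app f) HL).
    + intros x; apply (app_in Hf).
    + apply (app_injective Hf), Hi.
Qed.

(** The strictly decreasing sequence of [null_sequence] injects [omega] into the reals. *)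
Lemma countable_card_le_reals a : countable a -> card_le a (reals R).
Proof.
  intros H; destruct (countable_injection H) as (j & Hj & Hi).
  destruct null_sequence as (e & He & _ & Edec & _).
  assert (D : definable_term (fun v => app e (app j (v 0)))) by definability.
  assert (HF : is_fun (graph a (fun x => app e (app j x))) a (reals R)).
  { apply graph_is_fun; [exact D|]; intros x Hx; apply (app_in He), (app_in Hj Hx). }
  exists (graph a (fun x => app e (app j x))); split; [exact HF|].
  apply (app_injective HF); intros x y Hx Hy; rewrite !app_graph by assumption.
  intros E; apply Hi; auto.
  pose proof (app_in Hj Hx) as Hn; pose proof (app_in Hj Hy) as Hm.
  assert (K : forall n m, n ∈ omega -> m ∈ n -> app e n <> app e m).
  { intros n m Hn' Hm' E'; apply (lt_not_le (Edec n m Hn' Hm')).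
    rewrite E'; apply le_refl. }
  destruct (omega_total Hn Hm) as [L|[L|L]]; [|exact L|].
  - destruct (K _ _ Hm L); symmetry; exact E.
  - destruct (K _ _ Hn L); exact E.
Qed.

(** The common content of the four conclusions. A definable class is enough of an order for the
    least elements of finite sets to form a function of the model. *)
Definition orderable a : Prop :=
  exists lt, definable (fun v => lt (v 0) (v 1)) /\ linear_order lt a.

Lemma card_le_reals_orderable a : card_le a (reals R) -> orderable a.
Proof.
  intros (f & Hf & Hi); apply (order_of_injection (lt := rlt R) (f := f)
    (b := reals R)); auto using reals_order; definability.
Qed.

Lemma orderable_subset a b : orderable b -> subset a b -> orderable a.
Proof.
  intros (lt & Hlt & HL) H; exists lt; split; [exact Hlt|].
  apply (linear_order_subset HL H).
Qed.

(** The singleton of an isolated point is open, so every dense set contains all isolated points. *)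
Lemma separable_orderable X d : is_metric R X d -> separable X (metric_open R X d) ->
  orderable (Iso X d).
Proof.
  intros Hd (D & HD & _ & HDd); apply (orderable_subset (b := D)).
  - apply card_le_reals_orderable, countable_card_le_reals, HD.
  - intros x Hx; apply (Iso_is_Iso Hd) in Hx as (U & HU & E).
    destruct (HDd U HU) as (y & Hy & HyD); [exists x; apply E; reflexivity|].
    apply E in Hy as ->; exact HyD.
Qed.

Lemma Hilbert_cube_orderable X d : is_metric R X d ->
  embeds_in_Hilbert_cube R X (metric_open R X d) -> orderable (Iso X d).
Proof.
  intros Hd (w & I & e & Y & Hw & HI & _ & HY & A & HA & h & g & Hh & Hg & Hhg & _).
  apply is_omega_eq in Hw as ->.
  apply (orderable_subset (b := X)); [|apply (Iso_subset Hd)].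
  assert (HIR : subset I (reals R)).
  { intros x Hx; apply HI in Hx; apply (rf_le HR (proj1 Hx)). }
  assert (HAY : forall f, f ∈ A -> is_fun f omega I) by (intros f Hf; apply HY, HA, Hf).
  apply (order_of_injection (b := A) (f := h)
    (lt := fun f g => exists n, n ∈ omega /\ rlt R (app f n) (app g n) /\
      forall m, m ∈ n -> app f m = app g m)).
  - definability.
  - apply (lexicographic_order HIR HAY).
  - exact Hh.
  (* [h] is injective because its inverse relation [g] is a function. *)
  - intros x y z Hx Hy; apply Hhg in Hx, Hy.
    rewrite <- (app_eq Hg Hx), <- (app_eq Hg Hy); reflexivity.
Qed.

(** The two hypotheses are all that distinguishes the four conclusions. Passing from [CAC_fin] to
    iso-dense spaces, from these to scattered ones, and from a scattered space back to [CAC_fin]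
    closes a cycle that contains both equivalences. *)
Lemma CAC_fin_iff (C : M -> (M -> Prop) -> Prop) :
  (forall X d, is_metric R X d -> iso_dense X (metric_open R X d) ->
    countable (Iso X d) -> C X (metric_open R X d)) ->
  (forall X d, is_metric R X d -> C X (metric_open R X d) -> orderable (Iso X d)) ->
  (CAC_fin M <-> for_metric_spaces R iso_dense C) /\
  (CAC_fin M <-> for_metric_spaces R scattered C).
Proof.
  intros H1 H2.
  assert (F : CAC_fin M -> for_metric_spaces R iso_dense C).
  { intros CAC X d Hd HK Hc; apply H1; auto.
    apply (Iso_is_countable Hd CAC Hc). }
  assert (S : for_metric_spaces R iso_dense C -> for_metric_spaces R scattered C).
  { intros H X d Hd HK; apply (H X d Hd), (scattered_iso_dense Hd HK). }
  assert (B : for_metric_spaces R scattered C -> CAC_fin M).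
  { intros H G HG Hfin.
    destruct (disjoint_union_space HG) as (X & d & Z & Hd & HX & Hb & HZ & HGZ);
      [intros a Ha; apply Hfin, Ha|].
    destruct (orderable_subset (H2 X d Hd (H X d Hd HX (or_intror Hb))) HZ)
      as (lt & Hlt & HL).
    exact (choice_from_order Hlt HL HGZ Hfin). }
  tauto.
Qed.

(** * The four conclusions *)

Lemma iso_dense_separable X d : is_metric R X d ->
  iso_dense X (metric_open R X d) -> countable (Iso X d) ->
  separable X (metric_open R X d).
Proof.
  intros Hd (I & HI & HD) Hc; exists I; split; [|exact HD].
  rewrite (is_Iso_eq Hd HI); exact Hc.
Qed.

Lemma CAC_fin_iff_separable :
  (CAC_fin M <-> for_metric_spaces R iso_dense separable) /\
  (CAC_fin M <-> for_metric_spaces R scattered separable).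
Proof. apply CAC_fin_iff; [exact iso_dense_separable | exact separable_orderable]. Qed.

Lemma CAC_fin_iff_embeds :
  (CAC_fin M <-> for_metric_spaces R iso_dense (embeds_in_Hilbert_cube R)) /\
  (CAC_fin M <-> for_metric_spaces R scattered (embeds_in_Hilbert_cube R)).
Proof.
  apply CAC_fin_iff; [|exact Hilbert_cube_orderable].
  intros X d Hd HI Hc; apply (separable_embeds Hd), iso_dense_separable; assumption.
Qed.

Lemma CAC_fin_iff_continuum :
  (CAC_fin M <-> for_metric_spaces R iso_dense (Iso_le_continuum R)) /\
  (CAC_fin M <-> for_metric_spaces R scattered (Iso_le_continuum R)).
Proof.
  apply CAC_fin_iff.
  - intros X d Hd _ Hc; exists (Iso X d); split; [apply (Iso_is_Iso Hd)|].
    apply (countable_card_le_reals Hc).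
  - intros X d Hd (I & HI & Hc); apply card_le_reals_orderable.
    rewrite <- (is_Iso_eq Hd HI); exact Hc.
Qed.

Lemma CAC_fin_iff_countable :
  (CAC_fin M <-> for_metric_spaces R iso_dense Iso_countable) /\
  (CAC_fin M <-> for_metric_spaces R scattered Iso_countable).
Proof.
  apply CAC_fin_iff.
  - intros X d Hd _ Hc; exists (Iso X d); split; [apply (Iso_is_Iso Hd) | exact Hc].
  - intros X d Hd (I & HI & Hc); apply card_le_reals_orderable, countable_card_le_reals.
    rewrite <- (is_Iso_eq Hd HI); exact Hc.
Qed.

End Real.
End ZF.

Theorem theorem4p2 (M : set_structure) (HZF : ZF_model M)
    (R : field_data M) (HR : is_real_field R) :
  ((CAC_fin M <-> for_metric_spaces R iso_dense separable) /\
   (CAC_fin M <-> for_metric_spaces R iso_dense (embeds_in_Hilbert_cube R)) /\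
   (CAC_fin M <-> for_metric_spaces R iso_dense (Iso_le_continuum R)) /\
   (CAC_fin M <-> for_metric_spaces R iso_dense Iso_countable)) /\
  ((CAC_fin M <-> for_metric_spaces R scattered separable) /\
   (CAC_fin M <-> for_metric_spaces R scattered (embeds_in_Hilbert_cube R)) /\
   (CAC_fin M <-> for_metric_spaces R scattered (Iso_le_continuum R)) /\
   (CAC_fin M <-> for_metric_spaces R scattered Iso_countable)).
Proof.
  destruct (CAC_fin_iff_separable HZF HR), (CAC_fin_iff_embeds HZF HR),
    (CAC_fin_iff_continuum HZF HR), (CAC_fin_iff_countable HZF HR).
  tauto.
Qed.
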